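(* Let $\mathcal{M}$ be a smooth manifold, and for $i\in\{1,2\}$ let $\{f_{i,j}\}_{j=1}^{d_i}$ be smooth vector fields on $\mathcal{M}$, $J_i:\mathcal{M}\to\mathbb{R}$ a smooth function, and $\kappa_i>0$. Let $\mathcal{U}\subset\mathcal{M}$ be an open submanifold such that, with $\mathcal{E}_i(x):=\mathrm{span}_{\mathbb{R}}\{f_{i,j}(x)\}_{j=1}^{d_i}$, each $\mathcal{E}_i$ is a regular distribution on $\mathcal{U}$, $T_x\mathcal{U}=\mathcal{E}_1(x)\oplus\mathcal{E}_2(x)$ for all $x\in\mathcal{U}$, and, for each $i$, the family $\{f_{i,j}\}_{j=1}^{d_i}$ is linearly independent at every $x\in\mathcal{U}$. Suppose that $x^\star\in\mathcal{U}$ is a locally exponentially stable equilibrium point of the nominal dynamics $$\dot{x}=\sum_{i=1}^2\kappa_i\sum_{j=1}^{d_i}L_{f_{i,j}}(J_i)(x)\,f_{i,j}(x).$$ Then there exist an open neighborhood $\Omega\subset\mathbb{R}^{d_1\times d_2}$ with $0\in\Omega$ and a smooth map $X^\star:\Omega\to\mathcal{U}$ such that $X^\star(0)=x^\star$ and, for all $\gamma\in\Omega$, the point $X^\star(\gamma)$ is a locally exponentially stable equilibrium point of the deceptive dynamics $$\dot{x}=\sum_{i=1}^2\kappa_i\sum_{j=1}^{d_i}L_{\tilde f_{i,j}}(J_i)(x)\,\tilde f_{i,j}(x).$$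
   Context: A regular distribution is a smooth distribution of constant rank. $L_fJ(x)=dJ(x)[f(x)]$. For a matrix $\gamma\in\mathbb{R}^{d_1\times d_2}$ of constant deception parameters with entries $\gamma_j^k$ ($k\in\{1,\dots,d_1\}$, $j\in\{1,\dots,d_2\}$), the tilted vector fields are $$\tilde f_{1,j}:=f_{1,j}\ (1\le j\le d_1),\qquad \tilde f_{2,j}:=f_{2,j}+\sum_{k=1}^{d_1}\gamma_j^k f_{1,k}\ (1\le j\le d_2).$$ *)

(* Defs.v *)
From HB Require Import structures.
From mathcomp Require Import all_boot all_order all_algebra.
From mathcomp Require Import all_classical all_reals all_analysis.

Set Implicit Arguments.
Unset Strict Implicit.
Unset Printing Implicit Defensive.

Import Order.TTheory GRing.Theory Num.Theory.
Import numFieldNormedType.Exports.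

Local Open Scope classical_set_scope.
Local Open Scope ring_scope.

Section Smoothness.
Context {R : realType} {V W : normedModType R}.

(* C^k on an open set A of a finite-dimensional space: x |-> 'd f x is C^k
   iff all its evaluations x |-> 'D_v f x are. *)
Fixpoint Ck_on (k : nat) (A : set V) (f : V -> W) : Prop :=
  match k with
  | 0%N => {in A, continuous f}
  | k'.+1 => (forall x, A x -> differentiable f x) /\
             (forall v : V, Ck_on k' A (fun x => 'D_v f x))
  end.

Definition smooth_on (A : set V) (f : V -> W) : Prop := forall k, Ck_on k A f.

End Smoothness.

(* chart_map is only meaningful on chart_dom, and chart_inv on the image of
   chart_dom. *)
Record chart (R : realType) (n : nat) (M : topologicalType) := Chart {
  chart_dom : set M;
  chart_map : M -> 'rV[R]_n;
  chart_inv : 'rV[R]_n -> M;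
  chart_dom_open : open chart_dom;
  chart_img_open : open (chart_map @` chart_dom);
  chart_mapK : {in chart_dom, cancel chart_map chart_inv};
  chart_map_continuous : {in chart_dom, continuous chart_map};
  chart_inv_continuous : {in chart_map @` chart_dom, continuous chart_inv}
}.

(* The atlas need not be maximal: the notions below do not change when the atlas
   is enlarged by compatible charts. *)
Record smoothManifold (R : realType) (n : nat) := SmoothManifold {
  manifold_space :> topologicalType;
  manifold_hausdorff : hausdorff_space manifold_space;
  manifold_second_countable : @second_countable manifold_space;
  atlas : set (chart R n manifold_space);
  atlas_cover : forall x, exists2 c, atlas c & chart_dom c x;
  atlas_smooth : forall c c', atlas c -> atlas c' ->
    smooth_on (chart_map c @` (chart_dom c `&` chart_dom c'))
              (chart_map c' \o chart_inv c)
}.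

Section Manifolds.
Context {R : realType} {n : nat} (M : smoothManifold R n).

Definition chart_at (x : M) : chart R n M := projT1 (cid2 (atlas_cover x)).

(* The tangent space at x, a tangent vector being given by its components in the
   chart chart_at x. The components in any other chart c around x are obtained
   by applying the differential of the transition map, see coords. *)
Definition tangent (x : M) : Type := 'rV[R]_n.

HB.instance Definition _ (x : M) := Vector.copy (tangent x) 'rV[R]_n.

Definition coords (c : chart R n M) (x : M) (v : tangent x) : 'rV[R]_n :=
  'd (chart_map c \o chart_inv (chart_at x)) (chart_map (chart_at x) x) v.

Definition vector_field := forall x : M, tangent x.

Definition smooth_vector_field_on (A : set M) (f : vector_field) : Prop :=
  forall c, atlas c ->
    smooth_on (chart_map c @` (chart_dom c `&` A))
              (fun y => coords c (f (chart_inv c y))).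

Definition smooth_function (J : M -> R) : Prop :=
  forall c, atlas c -> smooth_on (chart_map c @` chart_dom c) (J \o chart_inv c).

Definition differential (J : M -> R) (x : M) (v : tangent x) : R :=
  'd (J \o chart_inv (chart_at x)) (chart_map (chart_at x) x) v.

Definition lie_derivative (f : vector_field) (J : M -> R) (x : M) : R :=
  differential J (f x).

Definition smooth_map_on (V : normedModType R) (A : set V) (X : V -> M) : Prop :=
  {in A, continuous X} /\
  forall c, atlas c ->
    smooth_on (A `&` X @^-1` chart_dom c) (chart_map c \o X).

Definition distribution := forall x : M, {vspace tangent x}.

Definition span_fields d (f : 'I_d -> vector_field) : distribution :=
  fun x => <<[seq f j x | j : 'I_d]>>%VS.

Definition smooth_distribution_on (A : set M) (E : distribution) : Prop :=
  forall x, A x -> exists m (g : 'I_m -> vector_field) (B : set M),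
    [/\ open B, B x,
        forall j, smooth_vector_field_on B (g j) &
        forall y, B y -> E y = span_fields g y].

Definition regular_distribution_on (A : set M) (E : distribution) : Prop :=
  smooth_distribution_on A E /\ exists r, forall x, A x -> (\dim (E x) = r)%N.

Definition linearly_independent_at d (f : 'I_d -> vector_field) (x : M) : Prop :=
  free [seq f j x | j : 'I_d].

(* x is a solution of x' = F(x) on [0, +oo[; its values at negative times are
   irrelevant. At t = 0 continuity suffices: the one-sided derivative there is
   then F (x 0) for continuous F. *)
Definition forward_solution (F : vector_field) (x : R -> M) : Prop :=
  {within [set t : R | 0 <= t], continuous x} /\
  forall t : R, 0 < t ->
    is_derive t (1 : R) (chart_map (chart_at (x t)) \o x) (F (x t)).

(* The exponential estimate is measured in a chart c around p; as transition maps
   are locally bi-Lipschitz, the choice of c does not matter. Solutions starting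
   near p are required to exist for all positive times. *)
Definition locally_exponentially_stable (F : vector_field) (p : M) : Prop :=
  F p = 0 /\
  exists2 c, atlas c /\ chart_dom c p &
  exists C lambda delta : R, [/\ 0 < C, 0 < lambda, 0 < delta &
    forall q, chart_dom c q -> `|chart_map c q - chart_map c p| < delta ->
      (exists2 x, forward_solution F x & x 0 = q) /\
      (forall x, forward_solution F x -> x 0 = q -> forall t : R, 0 <= t ->
        chart_dom c (x t) /\
        `|chart_map c (x t) - chart_map c p|
          <= C * expR (- (lambda * t)) * `|chart_map c q - chart_map c p|)].

Definition dynamics (kappa1 kappa2 : R) d1 d2
    (f1 : 'I_d1 -> vector_field) (f2 : 'I_d2 -> vector_field)
    (J1 J2 : M -> R) : vector_field :=
  fun x =>
    kappa1 *: (\sum_(j < d1) lie_derivative (f1 j) J1 x *: f1 j x) +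
    kappa2 *: (\sum_(j < d2) lie_derivative (f2 j) J2 x *: f2 j x).

(* gamma k j is the parameter with upper index k and lower index j. *)
Definition tilted_field d1 d2 (gamma : 'M[R]_(d1, d2))
    (f1 : 'I_d1 -> vector_field) (f2 : 'I_d2 -> vector_field) :
    'I_d2 -> vector_field :=
  fun j x => f2 j x + \sum_(k < d1) gamma k j *: f1 k x.

End Manifolds.

Arguments vector_field {R n} M.
Arguments distribution {R n} M.

(* Main.v *)
Require Import Defs.
From HB Require Import structures.
From mathcomp Require Import all_boot all_order all_algebra.
From mathcomp Require Import spectral complex ring lra.
From mathcomp Require Import all_classical all_reals all_analysis.
Set Implicit Arguments.
Unset Strict Implicit.
Unset Printing Implicit Defensive.
Import Order.TTheory GRing.Theory Num.Theory.
Import numFieldNormedType.Exports.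
Local Open Scope classical_set_scope.
Local Open Scope ring_scope.

(** The stable equilibrium persists because its exponential stability is seen by
    the linearization of the dynamics, and a stable linearization survives small
    perturbations. Everything happens in the chart in which the stability of
    [xstar] is measured: there the deceptive dynamics are a map [G (gamma, y)],
    jointly smooth in the parameter and the position, and [G (0, p) = 0] where
    [p] represents [xstar].

    - The linearization [A] of [G (0, _)] at [p] has no eigenvalue of nonnegative
      real part: a real or complex linear functional that is an eigenvector for
      such an eigenvalue cannot decay along solutions as fast as the exponential
      estimate requires ([stable_no_unstable_mode]). Hence, by a Schur
      triangularization over the complex numbers with rescaled coordinates, there
      is a quadratic form [|x Q|^2] which [A] strictly decreases
      ([hurwitz_lyapunov]).

    - Strict decrease is an open condition. It holds for the derivative of
      [G (gamma, _)] at all points of a fixed ball around [p] and all small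
      [gamma] ([uniform_nbhd]), and integrating it along segments shows that
      [G (gamma, _)] is strongly monotone there for the scalar product defined by
      [Q] ([strongly_monotone]).

    - Strong monotonicity yields the equilibria: a minimum of [|G (gamma, y) Q|^2]
      over a small ball is a zero ([zero_exists]), it is unique, it depends
      differentiably on [gamma], and the formula for its derivative makes it
      smooth by induction ([zero_smooth]). This is the implicit function theorem
      in the form needed here.

    - Strong monotonicity also yields their stability: [|(y - e) Q|^2] decays
      exponentially along solutions near the equilibrium [e]. Solutions exist by
      Picard iteration ([picard_lindelof]) applied to the vector field truncated
      outside a ball, and no solution on the manifold leaves the sublevel sets of
      the quadratic form, which are compact, hence closed since the manifold is
      Hausdorff ([sublevel_trapping], [dissipative_exponentially_stable]). *)

(** * Calculus of maps of class C^k *)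

Section Differentials.
Context {R : realType}.
Implicit Types V W : normedModType R.

(** Differentiability as an explicit estimate of the remainder, for maps whose
    remainder is bounded by hand rather than by the calculus of Landau symbols. *)
Lemma is_diff_bound V W (f : V -> W) x (L : {linear V -> W}) :
  continuous L ->
  (forall e : R, 0 < e ->
     \forall h \near (0 : V), `|f (h + x) - (f x + L h)| <= e * `|h|) ->
  is_diff x f L.
Proof.
move=> Lc fL.
have E : f \o shift x = cst (f x) + L +o_ (0 : V) id.
  by apply/eqaddoP => e e0; exact: fL.
have dE := diff_unique Lc E.
apply: DiffDef => //; apply/diff_locallyP; split; first by rewrite dE.
by rewrite dE.
Qed.

Lemma diff_bound V W (f : V -> W) x : differentiable f x ->
  forall e : R, 0 < e ->
     \forall h \near (0 : V), `|f (h + x) - (f x + 'd f x h)| <= e * `|h|.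
Proof. by move=> /diff_locally/eqaddoP fx e e0; exact: fx. Qed.

Lemma near_eq_diff V W (f g : V -> W) x : (\near x, f x = g x) ->
  differentiable f x -> is_diff x g ('d f x).
Proof.
move=> fg df; apply: is_diff_bound; first exact: diff_continuous.
move=> e e0; have fxg := nbhs_singleton fg.
have : \forall h \near (0 : V), f (h + x) = g (h + x).
  by move: fg; rewrite (near_shift 0)/=; apply: filterS => h /=; rewrite subr0.
have := diff_bound df e0.
by apply: filterS2 => h /[swap] <-; rewrite -fxg.
Qed.

Lemma derive_diffE V W (f : V -> W) x v L : is_diff x f L -> 'D_v f x = L v.
Proof. by move=> [df <-]; rewrite deriveE. Qed.

Lemma diff_is_derive V W (f : V -> W) x v L : is_diff x f L ->
  is_derive x v f (L v).
Proof.
by move=> fL; apply: DeriveDef; [apply/diff_derivable/ex_diff | exact: derive_diffE].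
Qed.

End Differentials.

Section CkCalculus.
Context {R : realType}.
Implicit Types (V W : normedModType R) (k : nat).

Lemma open_near V (A : set V) (P : V -> Prop) x : open A -> A x ->
  (forall y, A y -> P y) -> \forall y \near x, P y.
Proof.
move=> oA Ax AP; near=> y; apply: AP; near: y; exact: open_nbhs_nbhs.
Unshelve. all: by end_near. Qed.

Lemma Ck_continuous V W k (A : set V) (f : V -> W) x :
  Ck_on k A f -> A x -> {for x, continuous f}.
Proof.
case: k => [|k] /= Cf Ax; first by apply: Cf; rewrite inE.
by apply: differentiable_continuous; case: Cf => /(_ _ Ax).
Qed.

(** Openness matters: the directional derivatives at a point of [A] involve the
    nearby values of the maps, which are known to agree only inside [A]. *)
Lemma Ck_ext V W k (A : set V) (f g : V -> W) : open A ->
  (forall x, A x -> f x = g x) -> Ck_on k A f -> Ck_on k A g.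
Proof.
move=> oA; elim: k f g => [|k IH] f g fg /=.
  move=> Cf x /[dup] /set_mem Ax xA.
  have fgx : \near x, f x = g x by exact: open_near fg.
  rewrite /continuous_at -(fg x Ax); apply: cvg_trans (Cf x xA); exact: near_eq_cvg.
move=> [df Df].
have dg x : A x -> is_diff x g ('d f x).
  by move=> Ax; apply: near_eq_diff; [exact: open_near fg|exact: df].
split=> [x /dg[]//|v]; apply: IH (Df v) => x Ax.
by rewrite (derive_diffE v (dg x Ax)) deriveE//; exact: df.
Qed.

Lemma Ck_subset V W k (A B : set V) (f : V -> W) :
  B `<=` A -> Ck_on k A f -> Ck_on k B f.
Proof.
move=> BA; elim: k f => [|k IH] f /=.
  by move=> Cf x /set_mem /BA /mem_set; exact: Cf.
by move=> [df Df]; split=> [x /BA/df//|v]; exact: IH.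
Qed.

Lemma CkW V W k (A : set V) (f : V -> W) : Ck_on k.+1 A f -> Ck_on k A f.
Proof.
elim: k f => [|k IH] f; last by move=> [df Df]; split=> // v; exact: IH.
by move=> Cf x /set_mem Ax; apply: Ck_continuous Cf Ax.
Qed.

Lemma Ck_linear_comp V W W' k (A : set V) (f : V -> W) (L : {linear W -> W'}) :
  open A -> continuous L -> Ck_on k A f -> Ck_on k A (L \o f).
Proof.
move=> oA Lc; elim: k f => [|k IH] f /=.
  move=> Cf x xA; apply: continuous_comp; [exact: Cf|exact: Lc].
move=> [df Df].
have dg x : A x -> is_diff x (L \o f) (L \o 'd f x).
  move=> /df dfx; apply: is_diff_comp; first exact: differentiableP.
  by apply: DiffDef; [exact: linear_differentiable|rewrite diff_lin].
split=> [x /dg[]//|v].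
apply: (Ck_ext oA) (IH _ (Df v)) => x Ax.
by rewrite (derive_diffE v (dg x Ax)) /= deriveE//; exact: df.
Qed.

Lemma Ck_cst V W k (A : set V) (w : W) : Ck_on k A (cst w).
Proof.
elim: k w => [|k IH] w /=; first by move=> x _; exact: cst_continuous.
split=> [x _|v]; first exact: differentiable_cst.
rewrite (_ : (fun x => _) = cst 0); first exact: IH.
by apply/funext => x; rewrite derive_cst.
Qed.

Lemma Ck_linear V W k (A : set V) (L : {linear V -> W}) :
  continuous L -> Ck_on k A L.
Proof.
move=> Lc; case: k => [|k]; first by move=> x _; exact: Lc.
split=> [x _|v]; first exact: linear_differentiable.
rewrite (_ : (fun x => _) = cst (L v)); first exact: Ck_cst.
apply/funext => x; rewrite deriveE ?diff_lin//; exact: linear_differentiable.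
Qed.

Lemma CkD V W k (A : set V) (f g : V -> W) : open A ->
  Ck_on k A f -> Ck_on k A g -> Ck_on k A (fun x => f x + g x).
Proof.
move=> oA; elim: k f g => [|k IH] f g /=.
  by move=> Cf Cg x xA; apply: cvgD; [exact: Cf|exact: Cg].
move=> [df Df] [dg Dg].
have dfg x : A x -> is_diff x (f \+ g) ('d f x \+ 'd g x).
  by move=> Ax; apply: is_diffD; apply: differentiableP; [exact: df|exact: dg].
split=> [x /dfg[]//|v].
apply: (Ck_ext oA) (IH _ _ (Df v) (Dg v)) => x Ax.
by rewrite (derive_diffE v (dfg x Ax))/= !deriveE//; [exact: dg|exact: df].
Qed.

Lemma Ck_sum V W k (A : set V) (I : Type) (r : seq I) (P : pred I)
    (f : I -> V -> W) : open A ->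
  (forall i, P i -> Ck_on k A (f i)) ->
  Ck_on k A (fun x => \sum_(i <- r | P i) f i x).
Proof.
move=> oA Cf; elim: r => [|i r IH].
  by apply: (Ck_ext oA) (Ck_cst _ _ 0) => x _; rewrite big_nil.
have [Pi|nPi] := boolP (P i).
  by apply: (Ck_ext oA) (CkD oA (Cf i Pi) IH) => x _; rewrite big_cons Pi.
by apply: (Ck_ext oA) IH => x _; rewrite big_cons (negbTE nPi).
Qed.

Lemma CkM V k (A : set V) (f g : V -> R) : open A ->
  Ck_on k A f -> Ck_on k A g -> Ck_on k A (fun x => f x * g x).
Proof.
move=> oA; elim: k f g => [|k IH] f g.
  by move=> Cf Cg x xA; apply: cvgM; [exact: Cf|exact: Cg].
move=> Cf Cg; have [[df Df] [dg Dg]] := (Cf, Cg).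
have dfg x : A x -> is_diff x (f * g)
      (f x *: ('d g x : V -> R) + g x *: ('d f x : V -> R)).
  by move=> Ax; apply: is_diffM; apply: differentiableP; [exact: df|exact: dg].
split=> [x /dfg[]//|v].
apply: (Ck_ext oA) (CkD oA (IH _ _ (CkW Cf) (Dg v)) (IH _ _ (CkW Cg) (Df v))).
by move=> x Ax; rewrite (derive_diffE v (dfg x Ax))/= !deriveE//; [exact: df|exact: dg].
Qed.

Lemma Ck_prod V k (A : set V) (I : Type) (r : seq I) (P : pred I)
    (f : I -> V -> R) : open A ->
  (forall i, P i -> Ck_on k A (f i)) ->
  Ck_on k A (fun x => \prod_(i <- r | P i) f i x).
Proof.
move=> oA Cf; elim: r => [|i r IH].
  by apply: (Ck_ext oA) (Ck_cst _ _ (1 : R)) => x _; rewrite big_nil.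
have [Pi|nPi] := boolP (P i).
  by apply: (Ck_ext oA) (CkM oA (Cf i Pi) IH) => x _; rewrite big_cons Pi.
by apply: (Ck_ext oA) IH => x _; rewrite big_cons (negbTE nPi).
Qed.

Lemma CkV V k (A : set V) (f : V -> R) : open A ->
  (forall x, A x -> f x != 0) ->
  Ck_on k A f -> Ck_on k A (fun x => (f x)^-1).
Proof.
move=> oA f0; elim: k => [|k IH] Cf.
  move=> x xA; apply: cvgV; last exact: Cf.
  exact/f0/set_mem.
have [df Df] := Cf.
have CV := IH (CkW Cf).
split=> [x Ax|v]; first by apply: differentiableV; [exact: df|exact: f0].
apply: (Ck_ext oA) (CkM oA (Ck_cst _ _ (-1 : R)) (CkM oA (CkM oA CV CV) (Df v))).
move=> x Ax; rewrite deriveV ?f0//; last exact/diff_derivable/df.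
by rewrite /cst mulN1r scaleNr /GRing.scale/= -exprVn expr2.
Qed.

Lemma scaler_continuous W (w : W) : continuous (fun r : R => r *: w).
Proof. by move=> r; apply: cvgZr_tmp; exact: cvg_id. Qed.

Lemma Ck_mxP V k m n (A : set V) (f : V -> 'M[R]_(m, n)) : open A ->
  Ck_on k A f <-> forall i j, Ck_on k A (fun x => f x i j).
Proof.
move=> oA; split=> [Cf i j|Cf].
  have @L : {linear 'M[R]_(m, n) -> R}.
    by exists (fun N : 'M[R]_(_, _) => N i j); do 2![eexists]; do ?[constructor];
     rewrite ?mxE// => ? *; rewrite ?mxE//; move=> ?; rewrite !mxE.
  by have := @Ck_linear_comp _ _ _ k A f L oA (@coord_continuous _ _ _ _ _) Cf.
apply: (@Ck_ext _ _ _ _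
    (fun x => \sum_(i < m) \sum_(j < n) f x i j *: delta_mx i j)) => //.
  by move=> x _; rewrite [RHS]matrix_sum_delta.
apply: Ck_sum => // i _; apply: Ck_sum => // j _.
have sZ (w : 'M[R]_(m, n)) : scalable (fun r : R => r *: w).
  by move=> a r; rewrite scalerA.
have sD (w : 'M[R]_(m, n)) : {morph (fun r : R => r *: w) : a b / a + b}.
  by move=> a b; rewrite scalerDl.
pose w : 'M[R]_(m, n) := delta_mx i j.
pose L : {linear R -> 'M[R]_(m, n)} := HB.pack (fun r : R => r *: w)
  (GRing.isLinear.Build R R 'M[R]_(m, n) *:%R (fun r : R => r *: w)
     (fun a x y => etrans (sD w _ _) (congr2 +%R (sZ w _ _) erefl))).
by apply: (@Ck_linear_comp _ _ _ k A (fun x => f x i j) L oA) (Cf i j); exact: scaler_continuous.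
Qed.

Lemma CkZ V k m n (A : set V) (s : V -> R) (f : V -> 'M[R]_(m, n)) : open A ->
  Ck_on k A s -> Ck_on k A f -> Ck_on k A (fun x => s x *: f x).
Proof.
move=> oA Cs /(Ck_mxP _ _ oA) Cf; apply/Ck_mxP => // i j.
by apply: (Ck_ext oA) (CkM oA Cs (Cf i j)) => x _; rewrite mxE.
Qed.

Lemma Ck_mulmx V k m n p (A : set V) (f : V -> 'M[R]_(m, n)) (g : V -> 'M[R]_(n, p)) :
  open A -> Ck_on k A f -> Ck_on k A g -> Ck_on k A (fun x => f x *m g x).
Proof.
move=> oA /(Ck_mxP _ _ oA) Cf /(Ck_mxP _ _ oA) Cg; apply/Ck_mxP => // i j.
apply: (Ck_ext oA) (Ck_sum _ oA _) => [x _|l _]; first by rewrite mxE.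
exact: CkM.
Qed.

Lemma Ck_det V k n (A : set V) (f : V -> 'M[R]_n) : open A ->
  Ck_on k A f -> Ck_on k A (fun x => \det (f x)).
Proof.
move=> oA /(Ck_mxP _ _ oA) Cf; apply: Ck_sum => // s _.
apply: CkM => //; first exact: Ck_cst.
by apply: Ck_prod => // i _; exact: Cf.
Qed.

(** By Cramer's rule the entries of the inverse are rational functions of the
    entries of the matrix. *)
Lemma Ck_invmx V k n (A : set V) (f : V -> 'M[R]_n) : open A ->
  (forall x, A x -> f x \in unitmx) ->
  Ck_on k A f -> Ck_on k A (fun x => invmx (f x)).
Proof.
move=> oA fu Cf.
apply: (@Ck_ext _ _ _ _ (fun x => (\det (f x))^-1 *: \adj (f x))) => //.
  by move=> x Ax; rewrite /invmx fu.
apply: CkZ => //.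
  apply: CkV => //; last exact: Ck_det.
  by move=> x /fu; rewrite unitmxE unitfE.
apply/Ck_mxP => // i j.
apply: (@Ck_ext _ _ _ _ (fun x => cofactor (f x) j i)) => //.
  by move=> x _; rewrite mxE.
apply: CkM => //; first exact: Ck_cst.
apply: Ck_det => //; apply/Ck_mxP => // a b.
apply: (Ck_ext oA) ((Ck_mxP _ _ oA).1 Cf (lift j a) (lift i b)) => x _.
by rewrite !mxE.
Qed.

Lemma Ck_comp_linear V W W' k (B : set W) (A : set V) (g : W -> W')
    (L : {linear V -> W}) : open A -> continuous L ->
  (forall x, A x -> B (L x)) -> Ck_on k B g -> Ck_on k A (g \o L).
Proof.
move=> oA Lc AB; elim: k g => [|k IH] g.
  move=> Cg x xA; apply: continuous_comp; first exact: Lc.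
  by apply: Cg; apply/mem_set/AB/set_mem.
move=> [dg Dg].
have dgL x : A x -> is_diff x (g \o L) ('d g (L x) \o L).
  move=> Ax; apply: is_diff_comp.
    by apply: DiffDef; [exact: linear_differentiable|rewrite diff_lin].
  exact/differentiableP/dg/AB.
split=> [x /dgL[]//|v].
apply: (Ck_ext oA) (IH _ (Dg (L v))) => x Ax.
by rewrite (derive_diffE v (dgL x Ax))/= deriveE//; exact/dg/AB.
Qed.

(** The derivative of [u |-> H (u, X u)] along [v] is the partial derivative of
    [H] along [(v, 0)] plus the partial derivatives of [H] in the coordinate
    directions of the second factor, weighted by the coordinates of the
    derivative of [X]. These are maps of the same shape and of one class less, so
    an induction on the class goes through. Taking [H] independent of its first
    argument gives the usual composition. *)
Lemma Ck_comp_pair V k n (A : set V) (B : set (V * 'rV[R]_n)) (H : V * 'rV[R]_n -> R)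
    (X : V -> 'rV[R]_n) : open A ->
  (forall u, A u -> B (u, X u)) -> Ck_on k B H -> Ck_on k A X ->
  Ck_on k A (fun u => H (u, X u)).
Proof.
move=> oA AB; elim: k H => [|k IH] H.
  move=> CH CX u uA; apply: (@continuous_comp _ _ _ (fun u => (u, X u)) H).
    by have := cvg_pair (@cvg_id _ (nbhs u)) (CX u uA); exact.
  exact/CH/mem_set/AB/set_mem.
move=> CH CX; have [[dH DH] [dX DX]] := (CH, CX).
have dHX u : A u -> is_diff u (fun u => H (u, X u))
    ('d H (u, X u) \o (fun v => (v, 'd X u v))).
  move=> Au; apply: (@is_diff_comp _ _ _ _ (fun u => (u, X u))).
    by apply: is_diff_pair; exact/differentiableP/dX.
  exact/differentiableP/dH/AB.
split=> [u /dHX[]//|v].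
apply: (@Ck_ext _ _ _ _ (fun u => 'D_(v, 0) H (u, X u) +
   \sum_(j < n) 'D_v X u 0 j * 'D_(0, delta_mx 0 j) H (u, X u))) => //; last first.
  apply: CkD => //; first exact: (IH _ (DH (v, 0)) (CkW CX)).
  apply: Ck_sum => // j _; apply: CkM => //.
    exact: ((Ck_mxP _ _ oA).1 (DX v) 0 j).
  exact: (IH _ (DH (0, delta_mx 0 j)) (CkW CX)).
move=> u Au; rewrite (derive_diffE v (dHX u Au))/=.
have dHu := dH _ (AB _ Au).
rewrite (deriveE (v, 0) dHu) (deriveE _ (dX _ Au)).
under eq_bigr do rewrite (deriveE (0, delta_mx 0 _) dHu) -[_ * _]linearZ/=.
rewrite -linear_sum -linearD; congr ('d H _ _).
have pZ (c : R) (x : V) (y : 'rV[R]_n) : c *: (x, y) = (c *: x, c *: y) by [].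
have pD (x x' : V) (y y' : 'rV[R]_n) : (x, y) + (x', y') = (x + x', y + y') by [].
have -> : \sum_(j < n) 'd X u v 0 j *: (0 : V, delta_mx 0 j : 'rV[R]_n) = (0, 'd X u v).
  rewrite [in RHS](row_sum_delta ('d X u v)).
  elim/big_rec2 : _ => // j y1 y2 _ ->.
  by rewrite pZ pD scaler0 addr0.
by rewrite pD addr0 add0r.
Qed.

End CkCalculus.

(** * Quadratic Lyapunov functions of stable matrices *)

Section LinearAlgebra.
Context {R : realType}.

(** The norm carried by row vectors is the sup norm, which is not smooth along
    curves; this is the Euclidean product. *)
Definition dotp m (u v : 'rV[R]_m) : R := \sum_i u 0 i * v 0 i.

Lemma finite_positive_lower_bound n (x : 'I_n -> R) : (forall i, 0 < x i) ->
  exists2 mu : R, 0 < mu & forall i, mu <= x i.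
Proof.
elim: n x => [|n IH] x x0; first by exists 1 => // -[].
have [mu mu0 muP] := IH (fun i => x (lift ord0 i)) (fun i => x0 _).
exists (Num.min mu (x ord0)); first by rewrite lt_min mu0 x0.
move=> i; rewrite ge_min; case: (unliftP ord0 i) => [j ->|->].
  by rewrite muP.
by rewrite lexx orbT.
Qed.

(** The arithmetic-geometric inequality for the real part of a product of two
    complex numbers [a + i b] and [c - i d] with weights [w] and [v]. *)
Lemma normM_cross_le (a b c d w v : R) :
  `|w * v * (a * c + b * d)| <=
  (w ^+ 2 * (a ^+ 2 + b ^+ 2) + v ^+ 2 * (c ^+ 2 + d ^+ 2)) / 2.
Proof.
have := sqr_ge0 (w * a - v * c); have := sqr_ge0 (w * b - v * d).
have := sqr_ge0 (w * a + v * c); have := sqr_ge0 (w * b + v * d).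
by rewrite ler_norml => *; apply/andP; split; lra.
Qed.

(** For a complex lower triangular matrix [p + i q] whose diagonal has negative
    real part, the weights grow geometrically with the index, so that every
    coupling term lies between two coordinates of different weights and is
    multiplied by a small ratio; the diagonal then dominates. *)
Lemma triangular_dissipative n (p q : 'M[R]_n) :
  (forall i j : 'I_n, (i < j)%N -> p i j = 0 /\ q i j = 0) ->
  (forall j, p j j < 0) ->
  exists (w : 'I_n -> R) (mu : R), [/\ forall j, 0 < w j, 0 < mu &
    forall a b : 'I_n -> R,
    \sum_j w j ^+ 2 * (a j * (\sum_i (a i * p i j - b i * q i j)) +
                       b j * (\sum_i (a i * q i j + b i * p i j)))
    <= - mu * \sum_j w j ^+ 2 * (a j ^+ 2 + b j ^+ 2)].
Proof.
move=> trig neg.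
have [m2 m20 m2P] := @finite_positive_lower_bound n (fun j => - p j j)
  (fun j => etrans (oppr_gt0 _) (neg j)).
pose mu := m2 / 2; have mu0 : 0 < mu by rewrite divr_gt0.
pose K := \sum_i \sum_j (`|p i j| + `|q i j|).
have KP i j : `|p i j| + `|q i j| <= K.
  rewrite /K (bigD1 i)//= (bigD1 j)//= -addrA lerDl addr_ge0//.
    by apply: sumr_ge0 => *; rewrite addr_ge0.
  by apply: sumr_ge0 => *; apply: sumr_ge0 => *; rewrite addr_ge0.
have K0 : 0 <= K by apply: sumr_ge0 => *; apply: sumr_ge0 => *; rewrite addr_ge0.
(* With ratio [e] the [n] couplings of a coordinate, each at most [e * K], cost
   no more than half of the decay [2 * mu] given by the diagonal. *)
pose e := Num.min 1 (mu / (K * n%:R + 1)).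
have Kn0 : 0 <= K * n%:R by rewrite mulr_ge0.
have e0 : 0 < e by rewrite lt_min ltr01 divr_gt0// ltr_pwDr.
have e1 : e <= 1 by rewrite ge_min lexx.
have eKn : e * K * n%:R <= mu.
  have : e <= mu / (K * n%:R + 1) by rewrite ge_min lexx orbT.
  rewrite ler_pdivlMr ?ltr_pwDr// mulrDr mulr1 mulrA => h.
  by apply: le_trans h; rewrite lerDl ltW.
pose w (j : 'I_n) := e ^+ (n - j).
have w0 j : 0 < w j by rewrite exprn_gt0.
have we (i j : 'I_n) : (j < i)%N -> w j <= e * w i.
  move=> ji; rewrite /w -exprS; apply: ler_wiXn2l => //; first exact: ltW.
  exact: ltn_sub2l (ltn_ord j) ji.
exists w, mu; split=> // a b.
pose N j := w j ^+ 2 * (a j ^+ 2 + b j ^+ 2).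
have N0 j : 0 <= N j by rewrite mulr_ge0 ?addr_ge0 ?sqr_ge0.
pose t i j := w j ^+ 2 * (a j * (a i * p i j - b i * q i j) +
                          b j * (a i * q i j + b i * p i j)).
have tjj j : t j j <= - (2 * mu) * N j.
  have -> : t j j = p j j * N j by rewrite /t /N; ring.
  apply: ler_wpM2r => //; have := m2P j; rewrite /mu => ?; lra.
have tij i j : i != j -> t i j <= e * K * ((N i + N j) / 2).
  move=> nij; have NN : 0 <= (N i + N j) / 2 by rewrite divr_ge0 ?addr_ge0.
  have [ij|ji|/val_inj E] := ltngtP i j; last by rewrite E eqxx in nij.
    have [p0 q0] := trig _ _ ij.
    have -> : t i j = 0 by rewrite /t p0 q0; ring.
    by apply: mulr_ge0 => //; rewrite mulr_ge0// ltW.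
  pose r := w j / w i.
  have r0 : 0 <= r by rewrite divr_ge0// ltW.
  have re : r <= e by rewrite ler_pdivrMr// we.
  have -> : t i j = r * (p i j * (w i * w j * (a i * a j + b i * b j)) +
                         q i j * (w i * w j * (a i * b j + (- b i) * a j))).
    by rewrite /t /r; field; rewrite gt_eqF.
  have h1 := normM_cross_le (a i) (b i) (a j) (b j) (w i) (w j).
  have h2 := normM_cross_le (a i) (- b i) (b j) (a j) (w i) (w j).
  rewrite sqrrN (addrC (b j ^+ 2)) in h2.
  rewrite -/(N i) -/(N j) in h1 h2.
  apply: le_trans (_ : r * (K * ((N i + N j) / 2)) <= _); last first.
    by rewrite -mulrA ler_wpM2r// mulr_ge0.
  apply: ler_wpM2l => //.
  apply: le_trans (_ : (`|p i j| + `|q i j|) * ((N i + N j) / 2) <= _); last first.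
    exact: ler_wpM2r.
  rewrite mulrDl; apply: lerD.
    by rewrite (le_trans (ler_norm _))// normrM ler_wpM2l.
  by rewrite (le_trans (ler_norm _))// normrM ler_wpM2l.
have -> : \sum_j w j ^+ 2 * (a j * (\sum_i (a i * p i j - b i * q i j)) +
                       b j * (\sum_i (a i * q i j + b i * p i j))) =
    \sum_j \sum_i t i j.
  by apply: eq_bigr => j _; rewrite !mulr_sumr -big_split/= mulr_sumr.
apply: (@le_trans _ _ (\sum_j (- (2 * mu) * N j + \sum_i e * K * ((N i + N j) / 2)))).
  apply: ler_sum => j _; rewrite (bigD1 j)//= lerD//.
  rewrite [leRHS](bigD1 j)//= -[leLHS]add0r lerD//.
    by apply: mulr_ge0; [rewrite mulr_ge0// ltW|rewrite divr_ge0 ?addr_ge0].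
  by apply: ler_sum => i nij; exact: tij.
have S0 : 0 <= \sum_j N j by exact: sumr_ge0.
have -> : \sum_j (- (2 * mu) * N j + \sum_i e * K * ((N i + N j) / 2)) =
   (- (2 * mu) + e * K * n%:R) * \sum_j N j.
  rewrite big_split/= -mulr_sumr [RHS]mulrDl; congr (_ + _).
  under eq_bigr do rewrite -mulr_sumr -mulr_suml big_split/= sumr_const card_ord.
  rewrite -mulr_sumr -mulr_suml big_split/= sumr_const card_ord sumrMnl -mulr_natl.
  by field.
apply: ler_wpM2r => //; lra.
Qed.

(** The hypothesis is the real form of: [A] has no complex eigenvector
    [l1 + i l2] for an eigenvalue [a + i b] with [0 <= a]. By Schur's theorem [A]
    is triangular in a suitable complex basis; the real and imaginary parts of
    the weighted coordinate functionals of that basis are the columns of [Q]. *)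
Lemma hurwitz_lyapunov n (A : 'M[R]_n) :
  (forall (a b : R) (l1 l2 : 'cV[R]_n),
     A *m l1 = a *: l1 - b *: l2 -> A *m l2 = b *: l1 + a *: l2 -> 0 <= a ->
     l1 = 0 /\ l2 = 0) ->
  exists m (Q : 'M[R]_(n, m)) (mu : R), [/\ row_free Q, 0 < mu &
    forall x : 'rV[R]_n,
      dotp (x *m A *m Q) (x *m Q) <= - mu * dotp (x *m Q) (x *m Q)].
Proof.
case: n A => [A _|n A hA].
  exists 0%N, 0, 1; split=> //; first by rewrite /row_free mxrank0.
  by move=> x; rewrite /dotp !big_ord0 mulr0.
pose C : numClosedFieldType := R[i]%C.
pose iota : {rmorphism R -> C} := real_complex R.
pose Ac := map_mx iota A.
have [P Pu] := @Schur C _ Ac isT.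
have Pun := unitarymx_unit Pu.
rewrite /similar_to /= conjumx// => Ttrig.
set T := P *m Ac *m invmx P in Ttrig.
pose S := invmx P.
have AS : Ac *m S = S *m T by rewrite /S /T !mulmxA mulVmx// mul1mx.
clearbody T.
have Su : S \in unitmx by rewrite unitmx_inv.
pose p := map_mx (@complex.Re R) T; pose q := map_mx (@complex.Im R) T.
have trig (i j : 'I_n.+1) : (i < j)%N -> p i j = 0 /\ q i j = 0.
  by move=> ij; rewrite !mxE; move/is_trig_mxP: Ttrig => /(_ _ _ ij) ->.
have neg j : p j j < 0.
  rewrite ltNge; apply/negP => pj0.
  have : \det ((Ac - (T j j)%:M)^T) == 0.
    rewrite det_tr.
    have -> : Ac - (T j j)%:M = S *m (T - (T j j)%:M) *m P.
      rewrite mulmxBr mulmxBl -AS /S mulmxKV//; congr (_ - _).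
      by rewrite mul_mx_scalar -scalemxAl mulVmx// scalemx1.
    rewrite !det_mulmx [\det (T - _)]det_trig; last first.
      apply/is_trig_mxP => i k ik; rewrite !mxE.
      move/is_trig_mxP: Ttrig => /(_ _ _ ik) ->.
      by rewrite -val_eqE/= ltn_eqF// mulr0n subrr.
    by rewrite (bigD1 j)//= !mxE eqxx mulr1n subrr !(mul0r,mulr0).
  case/det0P => v v0 /(congr1 trmx); rewrite trmx_mul trmxK trmx0 mulmxBl => /eqP.
  rewrite subr_eq0 mul_scalar_mx => /eqP Av.
  pose l1 := map_mx (@complex.Re R) v^T; pose l2 := map_mx (@complex.Im R) v^T.
  have comp i : (A *m l1) i 0 = complex.Re ((Ac *m v^T) i 0) /\
                (A *m l2) i 0 = complex.Im ((Ac *m v^T) i 0).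
    split; rewrite !mxE (raddf_sum _); apply: eq_bigr => k _;
      by rewrite !mxE; case: (v 0 k) => x y; rewrite /= !(mul0r, addr0, subr0).
  have [l10 l20] : l1 = 0 /\ l2 = 0.
    apply: (hA (p j j) (q j j)) => //; apply/matrixP => i k; rewrite ord1.
      rewrite (comp i).1 Av !mxE.
      by case: (T j j) => x y; case: (v 0 i) => x' y' /=.
    rewrite (comp i).2 Av !mxE.
    by case: (T j j) => x y; case: (v 0 i) => x' y' /=; ring.
  case/eqP: v0; apply/matrixP => i k; rewrite ord1 mxE.
  move/matrixP: l10 => /(_ k 0); move/matrixP: l20 => /(_ k 0); rewrite !mxE.
  by case: (v 0 k) => x y /= -> ->.
have [w [mu [w0 mu0 wP]]] := triangular_dissipative trig neg.
pose Q : 'M[R]_(n.+1, n.+1 + n.+1) :=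
  row_mx (\matrix_(i, j) (w j * complex.Re (S i j)))
         (\matrix_(i, j) (w j * complex.Im (S i j))).
have xQ (x : 'rV[R]_n.+1) j :
    (x *m Q) 0 (lshift _ j) = w j * complex.Re ((map_mx iota x *m S) 0 j) /\
    (x *m Q) 0 (rshift _ j) = w j * complex.Im ((map_mx iota x *m S) 0 j).
  rewrite mul_mx_row row_mxEl row_mxEr; split; rewrite !mxE raddf_sum mulr_sumr;
    apply: eq_bigr => k _; rewrite !mxE; case: (S k j) => a b /=; ring.
exists _, Q, mu; split => //.
  apply: inj_row_free => x /matrixP xQ0.
  have : map_mx iota x *m S = 0.
    apply/matrixP => i j; rewrite ord1 [RHS]mxE.
    have := xQ0 0 (lshift _ j); rewrite (xQ x j).1 [RHS]mxE => /eqP.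
    rewrite mulf_eq0 gt_eqF//= => /eqP r0.
    have := xQ0 0 (rshift _ j); rewrite (xQ x j).2 [RHS]mxE => /eqP.
    rewrite mulf_eq0 gt_eqF//= => /eqP i0.
    by move: r0 i0; case: (_ 0 j) => a b /= -> ->.
  move=> /(congr1 (mulmx^~ P)); rewrite /= mulmxKV// mul0mx.
  by move/eqP; rewrite map_mx_eq0 => /eqP.
move=> x; have := wP (fun j => complex.Re ((map_mx iota x *m S) 0 j))
                     (fun j => complex.Im ((map_mx iota x *m S) 0 j)).
congr (_ <= _ * _).
  rewrite /dotp big_split_ord/= -big_split/=; apply: eq_bigr => j _.
  rewrite (xQ x j).1 (xQ x j).2 (xQ (x *m A) j).1 (xQ (x *m A) j).2.
  rewrite map_mxM -mulmxA AS mulmxA.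
  set u := map_mx iota x *m S.
  have -> : complex.Re ((u *m T) 0 j) =
      \sum_i (complex.Re (u 0 i) * p i j - complex.Im (u 0 i) * q i j).
    rewrite mxE raddf_sum; apply: eq_bigr => i _.
    rewrite /p /q [map_mx _ T i j]mxE [map_mx _ T i j]mxE.
    by case: (u 0 i) (T i j) => ? ? [].
  have -> : complex.Im ((u *m T) 0 j) =
      \sum_i (complex.Re (u 0 i) * q i j + complex.Im (u 0 i) * p i j).
    rewrite mxE raddf_sum; apply: eq_bigr => i _.
    rewrite /p /q [map_mx _ T i j]mxE [map_mx _ T i j]mxE.
    by case: (u 0 i) (T i j) => ? ? [].
  ring.
rewrite /dotp big_split_ord/= -big_split/=; apply: eq_bigr => j _.
rewrite (xQ x j).1 (xQ x j).2; ring.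
Qed.

End LinearAlgebra.

(** * Curves, exponential decay and trapping *)

Section Curves.
Context {R : realType}.
Implicit Types V W : normedModType R.

Lemma is_derive_comp_diff V W (y : R -> V) (g : V -> W) (t : R) (v : V) (L : V -> W) :
  is_derive t 1 y v -> is_diff (y t) g L -> is_derive t 1 (g \o y) (L v).
Proof.
move=> [/derivable1_diffP yt <-] gL.
rewrite deriveE//.
apply: (@diff_is_derive _ _ _ _ _ _ (L \o 'd y t)).
by apply: is_diff_comp => //; exact: differentiableP.
Qed.

Lemma mulmxr_continuous m n p (Q : 'M[R]_(n, p)) :
  continuous (fun x : 'M[R]_(m, n) => x *m Q).
Proof.
move=> x; apply: (@Ck_continuous _ _ _ 0 setT) => //.
by apply: Ck_mulmx; [exact: openT|move=> ? _; exact: cvg_id|exact: Ck_cst].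
Qed.

Lemma is_derive_coord m (y : R -> 'rV[R]_m) (t : R) (v : 'rV[R]_m) k : is_derive t 1 y v ->
  is_derive t 1 (fun s => y s 0 k) (v 0 k).
Proof.
move=> [dy <-]; apply: DeriveDef; first by move/derivable_mxP: dy.
by rewrite derive_mx// mxE.
Qed.

Lemma is_derive_rV m (y : R -> 'rV[R]_m) (t : R) (v : 'rV[R]_m) :
  (forall k, is_derive t 1 (fun s => y s 0 k) (v 0 k)) -> is_derive t 1 y v.
Proof.
move=> dy; have D : derivable y t 1.
  by apply/derivable_mxP => i j; rewrite ord1; case: (dy j).
apply: DeriveDef => //; rewrite derive_mx//; apply/matrixP => i j.
by rewrite ord1 mxE; case: (dy j).
Qed.

Lemma is_derive_dotp n m (Q : 'M[R]_(n, m)) (y : R -> 'rV[R]_n) (t : R) (v c : 'rV[R]_n) :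
  is_derive t 1 y v ->
  is_derive t 1 (fun s => dotp ((y s - c) *m Q) ((y s - c) *m Q))
            (2 * dotp (v *m Q) ((y t - c) *m Q)).
Proof.
move=> yv.
have yc : is_derive t 1 (fun s => y s - c) v.
  by have := is_deriveB yv (is_derive_cst c t 1); rewrite subr0.
have yQ k : is_derive t 1 (fun s => ((y s - c) *m Q) 0 k) ((v *m Q) 0 k).
  apply: is_derive_coord.
  apply: (@is_derive_comp_diff _ _ (fun s => y s - c) (mulmxr Q) _ _ (mulmxr Q)) => //.
  have Qc : continuous (mulmxr Q : 'rV[R]_n -> 'rV[R]_m) by exact: mulmxr_continuous.
  by apply: DiffDef; [exact: linear_differentiable|rewrite diff_lin].
have := is_derive_sum (fun k => is_deriveM (yQ k) (yQ k)).
rewrite (_ : \sum_(k < m) _ = (fun s => dotp ((y s - c) *m Q) ((y s - c) *m Q))); last first.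
  by apply/funext => s; rewrite /dotp fct_sumE.
move=> h; apply: is_derive_eq h _.
rewrite /dotp mulr_sumr; apply: eq_bigr => k _.
by rewrite /GRing.scale/=; ring.
Qed.

Lemma maxr_cst_continuous (c : R) : continuous (fun t : R => Num.max t c).
Proof. by move=> t; apply: continuous_max; [exact: cvg_id|exact: cvg_cst]. Qed.

Lemma minr_cst_continuous (c : R) : continuous (fun t : R => Num.min t c).
Proof. by move=> t; apply: continuous_min; [exact: cvg_id|exact: cvg_cst]. Qed.

(** Freezing a curve at negative times makes it continuous on the whole line, so
    that no subspace topology is needed afterwards. *)
Lemma continuous_comp_max0 (T : topologicalType) (x : R -> T) :
  {within [set t : R | 0 <= t], continuous x} ->
  continuous (fun t : R => x (Num.max t 0)).
Proof.
move=> /subspace_continuousP xc t.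
apply: (@cvg_comp _ _ _ (fun t : R => Num.max t 0) x _
    (within [set t : R | 0 <= t] (nbhs (Num.max t 0)))).
  move=> P PA; have nP := @maxr_cst_continuous 0 t [set y : R | 0 <= y -> P y] PA.
  have {}nP : \forall s \near t, 0 <= Num.max s 0 -> P (Num.max s 0) by exact: nP.
  by apply: filterS nP => s; apply; rewrite le_max lexx orbT.
by apply: xc; rewrite /= le_max lexx orbT.
Qed.

Lemma is_derive_expRM (mu s : R) : is_derive s 1 (fun s => expR (mu * s)) (mu * expR (mu * s)).
Proof.
have h : is_derive s (1:R) ( *%R mu : R -> R) mu.
  have := is_deriveZ mu (is_derive_id s (1:R)).
  by rewrite /GRing.scale/= mulr1.
have := is_derive1_comp (is_derive_expR (mu * s)) h.
by rewrite mulrC.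
Qed.

(** The derivative of [expR (mu * s) * w s] is nonpositive. *)
Lemma exp_decay (w dw : R -> R) (mu t : R) : 0 <= t -> continuous w ->
  (forall s, 0 < s < t -> is_derive s 1 w (dw s) /\ dw s <= - mu * w s) ->
  w t <= expR (- (mu * t)) * w 0.
Proof.
move=> t0 wc dwP.
pose g s := expR (mu * s) * w s.
have gd s : 0 < s < t -> is_derive s 1 g (expR (mu * s) * dw s + w s * (mu * expR (mu * s))).
  by move=> /dwP[ws _]; apply: (is_deriveM (is_derive_expRM mu s) ws).
have gc : {within `[0, t], continuous g}.
  apply: continuous_subspaceT => s; apply: cvgM; last exact: wc.
  have [/derivable1_diffP/differentiable_continuous h _] := is_derive_expRM mu s.
  exact: h.
have gt0 : g t <= g 0.
  apply: (@ler0_derive1_le_cc _ g 0 t) => //; rewrite ?in_itv/= ?lexx ?t0//.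
  - by move=> s; rewrite in_itv/= => /gd[].
  - move=> s; rewrite in_itv/= => st; rewrite derive1E; have [_ ->] := gd _ st.
    have -> : expR (mu * s) * dw s + w s * (mu * expR (mu * s)) =
              expR (mu * s) * (dw s + mu * w s) by ring.
    rewrite pmulr_rle0 ?expR_gt0//.
    by have [_ h] := dwP _ st; rewrite -lerBrDr sub0r -mulNr.
rewrite expRN ler_pdivlMl ?expR_gt0//.
by move: gt0; rewrite /g mulr0 expR0 mul1r.
Qed.

(** Consider the first time [t1] at which the curve could leave the sublevel set.
    It is still there at [t1] because the set is closed in the whole space and
    not merely in [D]; by the decay up to [t1] the value of [w] is then strictly
    below [rho], so the curve stays inside for some more time. *)
Lemma sublevel_trapping (T : topologicalType) (x : R -> T) (D : set T) (w : T -> R) (rho mu : R) :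
  open D -> (forall z, D z -> {for z, continuous w}) ->
  closed (D `&` [set z | w z <= rho]) -> 0 <= mu ->
  (forall z, D z -> 0 <= w z) ->
  {within [set t : R | 0 <= t], continuous x} ->
  D (x 0) -> w (x 0) < rho ->
  (forall t, 0 < t -> D (x t) -> w (x t) <= rho ->
     exists2 d, is_derive t 1 (w \o x) d & d <= - mu * w (x t)) ->
  forall t, 0 <= t -> D (x t) /\ w (x t) <= expR (- (mu * t)) * w (x 0).
Proof.
move=> oD wc cK mu0 w0 /continuous_comp_max0 xc Dx0 wx0 wd.
set X := fun t : R => x (Num.max t 0) in xc.
have X0 : X 0 = x 0 by rewrite /X maxxx.
have XE t : 0 <= t -> X t = x t by move=> t0; rewrite /X (max_idPl t0).
pose K := D `&` [set z | w z <= rho].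
have step t : 0 <= t -> (forall s, 0 <= s <= t -> K (X s)) ->
    w (X t) <= expR (- (mu * t)) * w (X 0).
  move=> t0 KX.
  (* Freezing the curve after [t] too makes [wX] continuous at every time,
     although [w] is only continuous on [D]. *)
  pose wX s := w (X (Num.min s t)).
  have wXt : wX t = w (X t) by rewrite /wX minxx.
  have wX0 : wX 0 = w (X 0) by rewrite /wX (min_idPl t0).
  rewrite -wXt -wX0.
  apply: (@exp_decay _ ('D_1 wX)) => //.
    move=> s; apply: (@continuous_comp _ _ _ (fun s => X (Num.min s t)) w).
      apply: (@continuous_comp _ _ _ (fun s => Num.min s t) X); last exact: xc.
      exact: minr_cst_continuous.
    apply: wc; have [|h] := leP 0 (Num.min s t).
      by move=> h; apply: (KX _ _).1; rewrite h ge_min lexx orbT.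
    by rewrite /X max_r ?(ltW h)//.
  move=> s /andP[s0 st].
  have Ks : K (X s) by apply: KX; rewrite !ltW.
  have [] := wd _ s0; rewrite -?(XE _ (ltW s0)); [exact: Ks.1|exact: Ks.2|].
  move=> d [wxd dE] dle.
  have wXd : is_derive s 1 wX d.
    apply: near_eq_is_derive (DeriveDef wxd dE).
    near=> u; rewrite /wX /= min_l ?XE//.
      by apply: ltW; near: u; exact: lt_nbhsr.
    by apply: ltW; near: u; exact: lt_nbhsl.
  have -> : 'D_1 wX s = d by case: wXd.
  split=> //.
  by rewrite /wX min_l ?(ltW st).
suff KX t : 0 <= t -> K (X t).
  move=> t t0; rewrite -X0 -(XE _ t0); split; first exact: (KX _ t0).1.
  by apply: step => // s /andP[s0 _]; exact: KX.
move: t; suff nnK : ~ ~ (forall t, 0 <= t -> K (X t)) by exact: contrapT nnK.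
move=> nK.
have [b0 [b00 nKb0]] : exists t, 0 <= t /\ ~ K (X t).
  by apply: contrapT => h; apply: nK => t t0; apply: contrapT => h'; apply: h; exists t.
pose B := [set t | 0 <= t /\ ~ K (X t)].
have Binf : has_inf B by split; [exists b0|exists 0 => t []].
pose t1 := inf B.
have t10 : 0 <= t1 by apply: lb_le_inf; [exists b0|move=> t []].
have Klt s : 0 <= s -> s < t1 -> K (X s).
  move=> s0 st; apply: contrapT => h.
  have : t1 <= s by apply: ge_inf; [exact: Binf.2|split].
  by rewrite leNgt st.
have Kt1 : K (X t1).
  have [E|t1p] := eqVneq t1 0; first by rewrite E X0; split=> //; exact: ltW.
  apply: contrapT => nKt1.
  have : \forall s \near t1, ~ K (X s).
    apply: (xc t1 (~` K)); apply: open_nbhs_nbhs; split => //.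
    exact: closed_openC.
  move=> nKs.
  have t1gt : 0 < t1 by rewrite lt_neqAle eq_sym t1p.
  have : \forall s \near t1^'-, False.
    near=> s; have : ~ K (X s) by near: s; exact: cvg_within nKs.
    by apply; apply: Klt; [apply: ltW; near: s; exact: nbhs_left_gt|near: s; exact: nbhs_left_lt].
  by move/filter_ex => [].
have wt1 : w (X t1) < rho.
  apply: le_lt_trans (step _ t10 _) _.
    move=> s /andP[s0]; rewrite le_eqVlt => /orP[/eqP->//|]; exact: Klt.
  apply: le_lt_trans wx0; rewrite -X0 ler_piMl//; first by apply: w0; rewrite X0.
  by rewrite -expR0 ler_expR oppr_le0 mulr_ge0.
have : \forall s \near t1, K (X s).
  have : \forall z \near X t1, K z.
    near=> z; split; first by near: z; apply: open_nbhs_nbhs; split => //; exact: Kt1.1.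
    apply: ltW; near: z; apply: (wc _ Kt1.1 [set r | r < rho]).
    exact: lt_nbhsl.
  exact: xc.
move=> /nbhs_ballP[e /= e0 eK].
have [b [b0' nKb] bt] : exists2 b, B b & b < t1 + e by exact: inf_adherent.
have t1b : t1 <= b by exact: ge_inf Binf.2 _ (conj b0' nKb).
apply: nKb; apply: eK.
by rewrite -ball_normE /ball_ /= ler0_norm ?subr_le0// opprB ltrBlDl.
Unshelve. all: by end_near. Qed.

End Curves.

(** * Global solutions of Lipschitz differential equations *)

Section Picard.
Context {R : realType}.

(** The integral starts at -1 so that 0 is interior to the domain on which the
    fundamental theorem of calculus applies. *)
Definition primitive (h : R -> R) (t : R) : R :=
  (\int[@lebesgue_measure R]_(s in `[(-1)%R, t]) h s -
   \int[@lebesgue_measure R]_(s in `[(-1)%R, 0%R]) h s)%R.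

Lemma primitive0 h : primitive h 0 = 0.
Proof. by rewrite /primitive subrr. Qed.

Lemma is_derive_primitive h (t : R) : continuous h -> 0 <= t ->
  is_derive t 1 (primitive h) (h t).
Proof.
move=> hc t0.
have ih : (@lebesgue_measure R).-integrable `[(-1)%R, (t + 1)%R] (EFin \o h).
  apply: continuous_compact_integrable; first exact: segment_compact.
  exact: continuous_subspaceT.
have t1 : -1 < t by rewrite (lt_le_trans _ t0)// ltrN10.
have tt : t < t + 1 by rewrite ltrDl.
have [dF FE] := continuous_FTC1_closed tt ih t1 (hc t).
have D := DeriveDef dF (esym (derive1E _ _)).
rewrite FE in D.
have := is_deriveB D (is_derive_cst
  (\int[@lebesgue_measure R]_(s in `[(-1)%R, 0%R]) h s)%R t (1 : R)).
by rewrite subr0; exact.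
Qed.

(** Integrating a bound that grows like [expR (lam * s)] divides it by [lam]. For
    [lam] twice the Lipschitz constant, this makes Picard's operator contract by
    a factor 2 on the whole half line, in the norm weighted by
    [expR (- lam * s)]. *)
Lemma exp_growth_bound (f df : R -> R) (c lam t : R) : 0 < lam -> 0 <= c -> 0 <= t ->
  f 0 = 0 -> (forall s : R, 0 <= s -> is_derive s 1 f (df s)) ->
  (forall s : R, 0 <= s -> `|df s| <= c * expR (lam * s)) ->
  `|f t| <= c / lam * expR (lam * t).
Proof.
move=> lam0 c0 t0 f0 fd dfc.
wlog suff H : f df f0 fd dfc / f t <= c / lam * expR (lam * t).
  rewrite ler_norml lerNl; apply/andP; split; last exact: (H f df).
  apply: (H (- f) (- df)); first by rewrite fctE f0 oppr0.
    by move=> s s0; apply: is_deriveN; exact: fd.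
  by move=> s s0; rewrite fctE normrN; exact: dfc.
pose g s := f s - c / lam * expR (lam * s).
have gd (s : R) : 0 <= s -> is_derive s (1 : R) g (df s - c * expR (lam * s)).
  move=> s0; have h := is_deriveB (fd _ s0) (is_deriveZ (c / lam) (is_derive_expRM lam s)).
  apply: is_derive_eq h _; rewrite /GRing.scale/= mulrA divfK// gt_eqF//.
have gc : {within `[0, t], continuous g}.
  apply: derivable_within_continuous => s; rewrite in_itv/= => /andP[s0 _].
  by have [] := gd _ s0.
have : g t <= g 0.
  apply: (@ler0_derive1_le_cc _ g 0 t) => //; rewrite ?in_itv/= ?lexx ?t0//.
  - by move=> s; rewrite in_itv/= => /andP[/ltW s0 _]; have [] := gd _ s0.
  - move=> s; rewrite in_itv/= => /andP[/ltW s0 _]; rewrite derive1E; have [_ ->] := gd _ s0.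
    by rewrite subr_le0 (le_trans (ler_norm _))// dfc.
rewrite /g f0 mulr0 expR0 mulr1 sub0r lerBlDr => /le_trans; apply.
by rewrite gerDr oppr_le0 divr_ge0// ltW.
Qed.

Lemma mx_norm_le m n (x : 'M[R]_(m, n)) (e : R) : 0 <= e ->
  (forall i j, `|x i j| <= e) -> `|x| <= e.
Proof.
by move=> e0 xe; rewrite /Num.Def.normr/= mx_normrE; apply: bigmax_le => // -[i j] _; exact: xe.
Qed.

Lemma coord_norm_le m n (x : 'M[R]_(m, n)) i j : `|x i j| <= `|x|.
Proof.
rewrite [leRHS]/Num.Def.normr/= mx_normrE.
exact: (le_bigmax _ (fun i : 'I_m * 'I_n => `|x i.1 i.2|) (i, j)).
Qed.

Lemma exp_growth_bound_rV n (f df : R -> 'rV[R]_n) (c lam t : R) : 0 < lam -> 0 <= c -> 0 <= t ->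
  f 0 = 0 -> (forall s : R, 0 <= s -> is_derive s 1 f (df s)) ->
  (forall s : R, 0 <= s -> `|df s| <= c * expR (lam * s)) ->
  `|f t| <= c / lam * expR (lam * t).
Proof.
move=> lam0 c0 t0 f0 fd dfc; apply: mx_norm_le.
  by rewrite mulr_ge0 ?expR_ge0// divr_ge0// ltW.
move=> i j; rewrite ord1.
apply: (@exp_growth_bound (fun s => f s 0 j) (fun s => df s 0 j)) => //.
- by rewrite f0 mxE.
- by move=> s s0; apply: is_derive_coord; exact: fd.
- by move=> s s0; apply: le_trans (dfc _ s0); exact: coord_norm_le.
Qed.

(** A sequence with geometrically decreasing increments converges, with an
    explicit rate that is used below to transfer bounds to the limit. *)
Lemma geometric_cvg n (u : nat -> 'rV[R]_n) (M : R) : 0 <= M ->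
  (forall k, `|u k.+1 - u k| <= M / 2 ^+ k) ->
  exists l : 'rV[R]_n, forall k, `|u k - l| <= 2 * M / 2 ^+ k.
Proof.
move=> M0 uM.
have p2 k : 0 < 2 ^+ k :> R by rewrite exprn_gt0.
have tel k m : `|u (m + k)%N - u k| <= 2 * M / 2 ^+ k - 2 * M / 2 ^+ (m + k).
  elim: m => [|m IH]; first by rewrite !subrr normr0.
  rewrite addSn -(subrK (u (m + k)%N) (u (m + k).+1)) -addrA.
  apply: le_trans (ler_normD _ _) _.
  apply: le_trans (lerD (uM _) IH) _.
  have -> : 2 * M / 2 ^+ (m + k).+1 = M / 2 ^+ (m + k).
    by rewrite exprS; field; rewrite gt_eqF.
  have -> : 2 * M / 2 ^+ (m + k) = M / 2 ^+ (m + k) + M / 2 ^+ (m + k) by ring.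
  lra.
have small k m : (k <= m)%N -> `|u m - u k| <= 2 * M / 2 ^+ k.
  move=> km; rewrite -(subnK km); apply: le_trans (tel _ _) _.
  by rewrite gerBl divr_ge0 ?mulr_ge0// ltW.
have to0 : (fun k => 2 * M / 2 ^+ k) @ \oo --> (0 : R).
  rewrite -[0](mulr0 (2 * M)); apply: cvgM; first exact: cvg_cst.
  under eq_fun do rewrite -exprVn.
  apply: cvg_expr; rewrite ger0_norm ?invr_ge0//.
  by rewrite invf_lt1// ltr1n.
have cu : cvg (u @ \oo).
  apply: cauchy_cvg; apply/cauchy_ballP => e e0.
  have e2 : 0 < e / 2 by rewrite divr_gt0.
  move/cvgrPdist_lt : to0 => /(_ _ e2) [N _ NP].
  have {}NP k : (N <= k)%N -> `|u k - u N| < e / 2.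
    move=> Nk; apply: le_lt_trans (small _ _ Nk) _.
    have := NP N (leqnn N); rewrite sub0r normrN ger0_norm//.
    by rewrite divr_ge0 ?mulr_ge0// ltW.
  exists (u @` [set k | (N <= k)%N], u @` [set k | (N <= k)%N]).
    by split; exists N => // k Nk; exists k.
  move=> [_ _] /= [[k Nk <-] [l Nl <-]].
  rewrite -ball_normE /= -(subrK (u N) (u k)) -addrA (splitr e).
  apply: le_lt_trans (ler_normD _ _) _; rewrite ltrD ?NP//.
  by rewrite -normrN opprB NP.
exists (lim (u @ \oo)) => k.
have c : (fun m => `|u k - u m|) @ \oo --> `|u k - lim (u @ \oo)|.
  by apply: cvg_norm; apply: cvgB => //; exact: cvg_cst.
rewrite -(cvg_lim _ c)//; apply: limr_le; first by apply/cvg_ex; eexists; exact: c.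
near=> m; rewrite -normrN opprB; apply: small; near: m; exact: nbhs_infty_ge.
Unshelve. all: by end_near. Qed.

Variables (n : nat) (G : 'rV[R]_n -> 'rV[R]_n) (L : R).
Hypotheses (L0 : 0 < L) (GL : forall x y, `|G x - G y| <= L * `|x - y|).

Let Gc : continuous G.
Proof.
move=> x; apply/(@cvgrPdist_lt _ _ _ (nbhs x)) => e e0.
have r0 : 0 < L^-1 * e by rewrite mulr_gt0// invr_gt0.
have := nbhsx_ballx x _ r0; rewrite -ball_normE; apply: filterS => y /= xy.
by apply: le_lt_trans (GL _ _) _; rewrite -ltr_pdivlMl.
Qed.

(** The time is truncated at 0 because the primitives have the expected
    derivative at nonnegative times only. *)
Definition picard_op (q : 'rV[R]_n) (y : R -> 'rV[R]_n) (t : R) : 'rV[R]_n :=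
  q + \row_j primitive (fun s => G (y s) 0 j) (Num.max t 0).

Let Gyc (y : R -> 'rV[R]_n) (j : 'I_n) : continuous y -> continuous (fun s => G (y s) 0 j).
Proof.
move=> yc s; apply: (@continuous_comp _ _ _ (fun s => G (y s)) (fun v => v 0 j)).
  by apply: continuous_comp; [exact: yc|exact: Gc].
exact: coord_continuous.
Qed.

Let picard_prim q y t := q + \row_j primitive (fun s => G (y s) 0 j) t : 'rV[R]_n.

Let is_derive_picard q y (t : R) : continuous y -> 0 <= t ->
  is_derive t 1 (picard_prim q y) (G (y t)).
Proof.
move=> yc t0; rewrite -[G (y t)]add0r; apply: is_deriveD.
apply: is_derive_rV => k.
under eq_fun do rewrite mxE.
by apply: is_derive_primitive => //; exact: Gyc.
Qed.

Let picard_continuous q y : continuous y -> continuous (picard_op q y).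
Proof.
move=> yc t; apply: (@continuous_comp _ _ _ (fun t : R => Num.max t 0) (picard_prim q y)).
  exact: maxr_cst_continuous.
have t0 : 0 <= Num.max t 0 by rewrite le_max lexx orbT.
by have [/derivable1_diffP/differentiable_continuous] := is_derive_picard q yc t0.
Qed.

Let picard_diff q (y z : R -> 'rV[R]_n) (c lam t : R) : 0 < lam -> 0 <= c -> 0 <= t ->
  continuous y -> continuous z ->
  (forall s, 0 <= s -> `|y s - z s| <= c * expR (lam * s)) ->
  `|picard_op q y t - picard_op q z t| <= L * c / lam * expR (lam * t).
Proof.
move=> lam0 c0 t0 yc zc yz; rewrite /picard_op (max_idPl t0).
apply: (@exp_growth_bound_rV _ (fun t => picard_prim q y t - picard_prim q z t)
          (fun s => G (y s) - G (z s))) => //.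
- by rewrite mulr_ge0// ltW.
- rewrite /picard_prim opprD addrACA subrr add0r; apply/matrixP => i j.
  by rewrite !mxE !primitive0 subrr.
- by move=> s s0; apply: is_deriveB; exact: is_derive_picard.
- by move=> s s0; apply: le_trans (GL _ _) _; rewrite -mulrA ler_wpM2l ?(ltW L0)// yz.
Qed.

(** The iterates of [picard_op] from the constant curve converge uniformly on
    bounded intervals, and the weighted contraction identifies the limit as a
    fixed point. *)
Lemma picard_lindelof (q : 'rV[R]_n) : exists y : R -> 'rV[R]_n,
  [/\ y 0 = q, continuous y & forall t : R, 0 < t -> is_derive t 1 y (G (y t))].
Proof.
pose lam := 2 * L; have lam0 : 0 < lam by rewrite mulr_gt0.
pose u k := iter k (picard_op q) (cst q).
have uc k : continuous (u k).
  elim: k => [|k IH]; first exact: cst_continuous.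
  exact: picard_continuous.
pose M := `|G q| / lam; have M0 : 0 <= M by rewrite divr_ge0// ltW.
have p2 k : 0 < 2 ^+ k :> R by rewrite exprn_gt0.
have uM k (t : R) : 0 <= t -> `|u k.+1 t - u k t| <= M / 2 ^+ k * expR (lam * t).
  elim: k t => [|k IH] t t0.
    rewrite expr0 divr1 /u /= /picard_op (max_idPl t0).
    apply: (@exp_growth_bound_rV _ (fun t => picard_prim q (cst q) t - cst q t)
          (fun s => G q)) => //.
    - by apply/matrixP => i j; rewrite !mxE primitive0 addr0 subrr.
    - move=> s s0; rewrite -[G q]subr0.
      exact: (is_deriveB (is_derive_picard q (@cst_continuous _ _ q) s0) (is_derive_cst q s 1)).
    - move=> s s0; rewrite ler_peMr// -expR0 ler_expR mulr_ge0//; exact: ltW.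
  have -> : M / 2 ^+ k.+1 = L * (M / 2 ^+ k) / lam.
    by rewrite /lam exprS; field; rewrite !gt_eqF.
  apply: (@picard_diff q (u k.+1) (u k)) => //; first by rewrite divr_ge0// ltW.
have ex_l (t : R) : {l : 'rV[R]_n | forall k,
    `|u k t - l| <= 2 * (M * expR (lam * Num.max t 0)) / 2 ^+ k}.
  apply: cid; apply: geometric_cvg; first by rewrite mulr_ge0// expR_ge0.
  move=> k; have [t0|t0] := leP 0 t.
    by rewrite mulrAC; exact: uM.
  have um i : u i t = u i 0 by case: i => //= i; rewrite /u /= /picard_op maxxx (max_idPr (ltW t0)).
  by rewrite !um mulrAC; exact: uM.
pose y t := projT1 (ex_l t).
have yP t k : `|u k t - y t| <= 2 * (M * expR (lam * Num.max t 0)) / 2 ^+ k := projT2 (ex_l t) k.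
have to0 (c : R) : (fun k => c / 2 ^+ k) @ \oo --> (0 : R).
  rewrite -[0](mulr0 c); apply: cvgM; first exact: cvg_cst.
  under eq_fun do rewrite -exprVn.
  apply: cvg_expr; rewrite ger0_norm ?invr_ge0//.
  by rewrite invf_lt1// ltr1n.
have yc : continuous y.
  move=> t; apply/cvgrPdist_lt => e e0.
  pose E := 2 * (M * expR (lam * (Num.max t 0 + 1))).
  have E0 : 0 <= E by do 2?apply: mulr_ge0 => //; exact: expR_ge0.
  have [k kP] : exists k, E / 2 ^+ k < e / 3.
    have e3 : 0 < e / 3 by rewrite divr_gt0.
    move/cvgrPdist_lt : (to0 E) => /(_ _ e3) [N _ NP]; exists N.
    have := NP N (leqnn N); rewrite /= sub0r normrN ger0_norm//.
    by rewrite divr_ge0// ltW.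
  have yk s : Num.max s 0 <= Num.max t 0 + 1 -> `|u k s - y s| < e / 3.
    move=> st; apply: le_lt_trans (yP s k) _; apply: le_lt_trans kP.
    by rewrite ler_pM2r ?invr_gt0// !ler_wpM2l// ler_expR ler_wpM2l// ltW.
  near=> s.
  have h1 : `|u k s - y s| < e / 3.
    apply: yk; apply: ltW; near: s.
    apply: (@maxr_cst_continuous R 0 t [set z | z < Num.max t 0 + 1]).
    by apply: lt_nbhsl; rewrite ltrDl.
  have h2 : `|u k t - y t| < e / 3 by apply: yk; rewrite lerDl.
  have h3 : `|u k t - u k s| < e / 3.
    near: s; apply: (cvgrPdist_lt _ _).1; first exact: uc.
    by rewrite divr_gt0.
  have -> : y t - y s = - (u k t - y t) + (u k t - u k s) + (u k s - y s).
    by rewrite opprB subrKA subrKA.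
  apply: le_lt_trans (ler_normD _ _) _.
  apply: le_lt_trans (lerD (ler_normD _ _) (lexx _)) _.
  rewrite normrN; lra.
have fix_y (t : R) : 0 <= t -> y t = picard_op q y t.
  move=> t0; apply/eqP; rewrite -subr_eq0 -normr_le0.
  pose E := 2 * (M * expR (lam * t)).
  have E0 : 0 <= E by do 2?apply: mulr_ge0 => //; exact: expR_ge0.
  have B k : `|y t - picard_op q y t| <= (E + E) / 2 ^+ k.
    have -> : y t - picard_op q y t = - (u k.+1 t - y t) + (u k.+1 t - picard_op q y t).
      by rewrite opprB addrA subrK.
    apply: le_trans (ler_normD _ _) _; rewrite normrN mulrDl; apply: lerD.
      apply: le_trans (yP t k.+1) _; rewrite (max_idPl t0) -/E exprS.
      rewrite ler_wpM2l// lef_pV2 ?posrE ?mulr_gt0//.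
      by rewrite ler_peMl ?ler1n// ltW.
    apply: le_trans (_ : L * (2 * M / 2 ^+ k) / lam * expR (lam * t) <= _).
      apply: picard_diff => //; first by apply: divr_ge0; [exact: mulr_ge0|exact: ltW].
      move=> s s0; apply: le_trans (yP s k) _; rewrite (max_idPl s0).
      by rewrite mulrA -mulrAC.
    have -> : L * (2 * M / 2 ^+ k) / lam * expR (lam * t) = E / 2 ^+ k / 2.
      by rewrite /lam /E; field; rewrite !gt_eqF.
    rewrite ler_pdivrMr// ler_peMr ?ler1n// divr_ge0// ltW.
  rewrite -(cvg_lim _ (to0 (E + E)))//; apply: limr_ge.
    by apply/cvg_ex; eexists; exact: to0.
  by near=> k; exact: B.
exists y; split=> //.
  rewrite fix_y// /picard_op maxxx; apply/matrixP => i j.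
  by rewrite !mxE primitive0 addr0.
move=> t t0; apply: near_eq_is_derive (is_derive_picard q yc (ltW t0)).
near=> s; rewrite fix_y /picard_op; last first.
  by apply: ltW; near: s; exact: lt_nbhsr.
rewrite (max_idPl _)//; apply: ltW; near: s; exact: lt_nbhsr.
Unshelve. all: by end_near. Qed.

End Picard.

(** * Quadratic forms and their variation along lines *)

Section QuadraticForms.
Context {R : realType}.

Lemma dotpE m (u v : 'rV[R]_m) : dotp u v = (u *m v^T) 0 0.
Proof. by rewrite mxE; apply: eq_bigr => i _; rewrite mxE. Qed.

Lemma dotpDl m (u v w : 'rV[R]_m) : dotp (u + v) w = dotp u w + dotp v w.
Proof. by rewrite !dotpE mulmxDl mxE. Qed.

Lemma dotpNl m (u w : 'rV[R]_m) : dotp (- u) w = - dotp u w.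
Proof. by rewrite !dotpE mulNmx mxE. Qed.

Lemma dotp0l m (w : 'rV[R]_m) : dotp 0 w = 0.
Proof. by rewrite !dotpE mul0mx mxE. Qed.

Lemma dotp_ge0 m (u : 'rV[R]_m) : 0 <= dotp u u.
Proof. by apply: sumr_ge0 => i _; rewrite -expr2 sqr_ge0. Qed.

Lemma dotp_le m (u v : 'rV[R]_m) : `|dotp u v| <= m%:R * `|u| * `|v|.
Proof.
apply: le_trans (ler_norm_sum _ _ _) _.
apply: le_trans (_ : \sum_(i < m) `|u| * `|v| <= _).
  by apply: ler_sum => i _; rewrite normrM ler_pM// coord_norm_le.
by rewrite sumr_const card_ord -[leLHS]mulr_natl mulrA.
Qed.

Lemma sqr_norm_le_dotp m (u : 'rV[R]_m) : `|u| ^+ 2 <= dotp u u.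
Proof.
have -> : dotp u u = Num.sqrt (dotp u u) ^+ 2 by rewrite sqr_sqrtr ?dotp_ge0.
rewrite ler_pXn2r ?nnegrE ?sqrtr_ge0//.
apply: mx_norm_le; first exact: sqrtr_ge0.
move=> i j; rewrite ord1 -sqrtr_sqr ler_wsqrtr// /dotp (bigD1 j)//= -expr2 lerDl.
by apply: sumr_ge0 => k _; rewrite -expr2 sqr_ge0.
Qed.

Lemma norm_mulmx_le m n (v : 'rV[R]_n) (E : 'M[R]_(n, m)) :
  `|v *m E| <= n%:R * `|E| * `|v|.
Proof.
apply: mx_norm_le; first by rewrite !mulr_ge0.
move=> i j; rewrite mxE; apply: le_trans (ler_norm_sum _ _ _) _.
apply: le_trans (_ : \sum_(i < n) `|E| * `|v| <= _).
  by apply: ler_sum => k _; rewrite normrM mulrC ler_pM// coord_norm_le.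
by rewrite sumr_const card_ord -[leLHS]mulr_natl mulrA.
Qed.

(** A right inverse of [Q] bounds [x] by [x *m Q]. *)
Lemma dotp_norm_equiv n m (Q : 'M[R]_(n, m)) : row_free Q ->
  exists a b : R, [/\ 0 < a, 0 < b & forall x : 'rV[R]_n,
    a * `|x| ^+ 2 <= dotp (x *m Q) (x *m Q) <= b * `|x| ^+ 2].
Proof.
move=> /row_freeP[Q' QQ'].
pose k := m%:R * `|Q'| + 1 : R; have k0 : 0 < k by rewrite ltr_wpDl ?mulr_ge0.
pose b := m%:R * (n%:R * `|Q|) ^+ 2 + 1 : R.
exists (k ^-2), b; split; first by rewrite invr_gt0 exprn_gt0.
  by rewrite ltr_wpDl ?mulr_ge0// sqr_ge0.
move=> x; apply/andP; split.
  rewrite ler_pdivrMl ?exprn_gt0//.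
  apply: le_trans (_ : (k * `|x *m Q|) ^+ 2 <= _); last first.
    by rewrite exprMn ler_wpM2l ?sqr_ge0// sqr_norm_le_dotp.
  rewrite ler_pXn2r ?nnegrE ?mulr_ge0 ?(ltW k0)//.
  rewrite -{1}[x]mulmx1 -QQ' mulmxA; apply: le_trans (norm_mulmx_le _ _) _.
  by rewrite ler_wpM2r// lerDl.
apply: le_trans (ler_norm _) _; apply: le_trans (dotp_le _ _) _.
have h := norm_mulmx_le x Q; rewrite /b; set c := n%:R * `|Q| in h *.
rewrite mulrDl mul1r -[leLHS]addr0 lerD ?sqr_ge0// -[leLHS]mulrA -[leRHS]mulrA.
rewrite ler_wpM2l// -expr2 -exprMn ler_pXn2r ?nnegrE//.
by rewrite !mulr_ge0.
Qed.

Lemma derive_lt0_right (f : R -> R) (t d : R) : is_derive t 1 f d -> d < 0 ->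
  \forall h \near 0^'+, f (h + t) < f t.
Proof.
move=> [df <-] d0.
have H : h^-1 *: (f (h *: 1 + t) - f t) @[h --> 0^'] --> 'D_1 f t by exact: df.
have {}H : \forall h \near 0^'+, h^-1 *: (f (h *: 1 + t) - f t) < 0.
  have nb : nbhs ('D_1 f t) [set z | z < 0] by exact: lt_nbhsl.
  exact: (cvg_dnbhs_at_right H nb).
near=> h.
have h0 : 0 < h by near: h; exact: nbhs_right_gt.
have : h^-1 *: (f (h *: 1 + t) - f t) < 0 by near: h.
by rewrite /GRing.scale/= pmulr_rlt0 ?invr_gt0// mulr1 subr_lt0.
Unshelve. all: by end_near. Qed.

Lemma is_derive_scalel (V : normedModType R) (w : V) (t : R) :
  is_derive t 1 (fun s : R => s *: w) w.
Proof.
have := @diff_is_derive R _ _ _ t 1 _ (is_diff_scalel t w).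
by rewrite scale1r.
Qed.

Lemma is_derive_line (V : normedModType R) (y w : V) (t : R) :
  is_derive t 1 (fun s : R => y + s *: w) w.
Proof.
by have := is_deriveD (is_derive_cst y t 1) (is_derive_scalel w t); rewrite add0r.
Qed.

Lemma dotp_continuous m : continuous (fun u : 'rV[R]_m => dotp u u).
Proof.
move=> u; apply: (@Ck_continuous _ _ _ 0 setT) => //.
have oT := @openT 'rV[R]_m.
have C j : @Ck_on R 'rV[R]_m R 0 setT (fun u => u 0 j).
  by move=> x _; exact: coord_continuous.
by apply: Ck_sum => // j _; apply: CkM.
Qed.

Lemma quad_continuous n m (Q : 'M[R]_(n, m)) (q : 'rV[R]_n) :
  continuous (fun y : 'rV[R]_n => dotp ((y - q) *m Q) ((y - q) *m Q)).
Proof.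
move=> y; apply: (@continuous_comp _ _ _ (fun y : 'rV[R]_n => (y - q) *m Q) (fun u => dotp u u)).
  apply: (@continuous_comp _ _ _ (fun y : 'rV[R]_n => y - q) (mulmx^~ Q)).
    by apply: (@cvgB _ _ _ (nbhs y)); [exact: cvg_id|exact: cvg_cst].
  exact: mulmxr_continuous.
exact: dotp_continuous.
Qed.

End QuadraticForms.

(** * Zeros of a dissipative family of maps *)

Section ParametricZero.
Context {R : realType} {U : normedModType R} {n m : nat}.
Variables (G : U * 'rV[R]_n -> 'rV[R]_n) (B : set (U * 'rV[R]_n)) (p : 'rV[R]_n).
Variables (Q : 'M[R]_(n, m)) (mu : R).

(** The partial derivative of [G] in its second argument, as a matrix that acts
    on row vectors from the right. *)
Definition jac2 z : 'M[R]_n := \matrix_(i, j) ('D_(0, delta_mx 0 i) G z) 0 j.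

Hypotheses (oB : open B) (smG : smooth_on B G) (Bp : B (0, p)) (Gp : G (0, p) = 0).
Hypotheses (Qfree : row_free Q) (mu0 : 0 < mu).
Hypothesis lyap : forall v : 'rV[R]_n,
  dotp (v *m jac2 (0, p) *m Q) (v *m Q) <= - mu * dotp (v *m Q) (v *m Q).

Let W (v : 'rV[R]_n) := dotp (v *m Q) (v *m Q).

Lemma smooth_differentiable z : B z -> differentiable G z.
Proof. by move=> Bz; have [/(_ _ Bz)] := smG 1. Qed.

Lemma smooth_continuous z : B z -> {for z, continuous G}.
Proof. by move/smooth_differentiable/differentiable_continuous. Qed.

Lemma diff_jac2 z v : B z -> 'd G z (0, v) = v *m jac2 z.
Proof.
move=> Bz; have dGz := smooth_differentiable Bz.
have -> : (0 : U, v) = \sum_(j < n) v 0 j *: (0 : U, delta_mx 0 j : 'rV[R]_n).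
  have pZ (c : R) (x : U) (y : 'rV[R]_n) : c *: (x, y) = (c *: x, c *: y) by [].
  have pD (x x' : U) (y y' : 'rV[R]_n) : (x, y) + (x', y') = (x + x', y + y') by [].
  rewrite [in LHS](row_sum_delta v).
  by elim/big_rec2 : _ => // j y1 y2 _ <-; rewrite pZ pD scaler0 addr0.
rewrite linear_sum mulmx_sum_row; apply: eq_bigr => j _; rewrite linearZ/=; congr (_ *: _).
by apply/matrixP => a b; rewrite ord1 !mxE deriveE.
Qed.

Lemma Ck_jac2 k : Ck_on k B jac2.
Proof.
apply/Ck_mxP => // i j.
apply: (@Ck_ext _ _ _ _ _ (fun z => ('D_(0, delta_mx 0 i) G z) 0 j)) => //.
  by move=> z _; rewrite mxE.
have [_ /(_ (0, delta_mx 0 i)) D] := smG k.+1.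
exact: ((Ck_mxP _ _ oB).1 D 0 j).
Qed.

(** The inequality [lyap] leaves room for a perturbation of the derivative, at
    the price of half of the rate [mu]. *)
Lemma uniform_nbhd : exists r K : R, [/\ 0 < r, 0 < K & forall g y,
  `|g| < r -> `|y - p| <= r ->
  [/\ B (g, y),
      forall v : 'rV[R]_n, dotp (v *m jac2 (g, y) *m Q) (v *m Q) <= - (mu / 2) * W v &
      forall v : 'rV[R]_n, `|v *m jac2 (g, y)| <= K * `|v| ]].
Proof.
have [a [b [a0 b0 abP]]] := dotp_norm_equiv Qfree.
(* A change of the derivative by at most [e] changes the quadratic expression at
   [v] by at most [c * e * `|v| ^+ 2], hence by at most [mu / 2 * W v]. *)
pose c := m%:R * (n%:R * `|Q|) ^+ 2 * n%:R : R.
have c0 : 0 <= c by rewrite !mulr_ge0// sqr_ge0.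
pose e := a * (mu / 2) / (c + 1).
have e0 : 0 < e by rewrite divr_gt0 ?mulr_gt0 ?divr_gt0// ltr_wpDl.
have JB : \forall z \near (0 : U, p), B z /\ `|jac2 (0, p) - jac2 z| < e.
  have h1 : \forall z \near (0 : U, p), B z by exact: open_nbhs_nbhs.
  have h2 : \forall z \near (0 : U, p), `|jac2 (0, p) - jac2 z| < e.
    have Jc := Ck_continuous (Ck_jac2 0) Bp.
    have := Jc _ (nbhsx_ballx (jac2 (0, p)) e e0).
    by rewrite -ball_normE.
  by near=> z; split; near: z.
have [r /= r0 rP] := (nbhs_ballP _ _).1 JB.
exists (r / 2), (n%:R * (`|jac2 (0, p)| + e) + 1); split.
- by rewrite divr_gt0.
- by rewrite ltr_wpDl// mulr_ge0// addr_ge0// ltW.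
move=> g y gr yr.
have r2 : r / 2 < r by rewrite ltr_pdivrMr// ltr_pMr// ltr1n.
have [Bz Jz] : B (g, y) /\ `|jac2 (0, p) - jac2 (g, y)| < e.
  apply: rP; split; rewrite -ball_normE /=.
    by rewrite sub0r normrN (lt_trans gr).
  by rewrite distrC (le_lt_trans yr).
split=> // v; last first.
  apply: le_trans (norm_mulmx_le _ _) _; apply: ler_wpM2r => //.
  apply: le_trans (_ : n%:R * (`|jac2 (0, p)| + e) <= _); last by rewrite lerDl.
  rewrite ler_wpM2l// -[jac2 (g, y)](subKr (jac2 (0, p))).
  by apply: le_trans (ler_normB _ _) _; rewrite lerD2l ltW.
have -> : v *m jac2 (g, y) *m Q = v *m jac2 (0, p) *m Q + v *m (jac2 (g, y) - jac2 (0, p)) *m Q.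
  by rewrite mulmxBr mulmxBl addrC subrK.
rewrite dotpDl; have := lyap v; rewrite -/(W v) => hl.
have /andP[aW _] := abP v; rewrite -/(W v) in aW.
have : dotp (v *m (jac2 (g, y) - jac2 (0, p)) *m Q) (v *m Q) <= c * e * `|v| ^+ 2.
  apply: le_trans (ler_norm _) _; apply: le_trans (dotp_le _ _) _.
  have hJ : `|jac2 (g, y) - jac2 (0, p)| <= e by rewrite distrC ltW.
  have h1 : `|v *m (jac2 (g, y) - jac2 (0, p)) *m Q| <= n%:R * `|Q| * (n%:R * e * `|v|).
    apply: le_trans (norm_mulmx_le _ _) _; rewrite ler_wpM2l ?mulr_ge0//.
    apply: le_trans (norm_mulmx_le _ _) _; rewrite ler_wpM2r//.
    by rewrite ler_wpM2l.
  have h2 := norm_mulmx_le v Q.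
  apply: le_trans (_ : m%:R * (n%:R * `|Q| * (n%:R * e * `|v|)) * (n%:R * `|Q| * `|v|) <= _).
    by apply: ler_pM => //; rewrite ?mulr_ge0 ?ler_wpM2l.
  rewrite (_ : m%:R * _ * _ = c * e * `|v| ^+ 2)//.
  by rewrite /c; ring.
have ce : c * e <= a * (mu / 2).
  rewrite /e mulrA ler_pdivrMr ?ltr_wpDl// mulrC ler_wpM2l ?lerDl//.
  by rewrite mulr_ge0 ?divr_ge0 ?ltW.
have h3 : c * e * `|v| ^+ 2 <= (mu / 2) * W v.
  apply: le_trans (_ : a * (mu / 2) * `|v| ^+ 2 <= _); first by rewrite ler_wpM2r ?sqr_ge0.
  by rewrite mulrAC mulrC ler_wpM2l// divr_ge0 ?ltW.
have -> : - (mu / 2) * W v = - mu * W v + mu / 2 * W v by field.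
by move=> h; apply: lerD => //; exact: le_trans h h3.
Unshelve. all: by end_near. Qed.

Variables (r K : R).
Hypotheses (r0 : 0 < r) (K0 : 0 < K).
Hypothesis nbhdP : forall g y, `|g| < r -> `|y - p| <= r ->
  [/\ B (g, y),
      forall v : 'rV[R]_n, dotp (v *m jac2 (g, y) *m Q) (v *m Q) <= - (mu / 2) * W v &
      forall v : 'rV[R]_n, `|v *m jac2 (g, y)| <= K * `|v| ].

Lemma segment_ball (y y' : 'rV[R]_n) (t : R) : 0 <= t <= 1 ->
  `|y - p| <= r -> `|y' - p| <= r -> `|y' + t *: (y - y') - p| <= r.
Proof.
move=> /andP[t0 t1] yr yr'.
have -> : y' + t *: (y - y') - p = (1 - t) *: (y' - p) + t *: (y - p).
  by rewrite !scalerBr !scalerBl !scale1r; apply/matrixP => i j; rewrite !mxE; ring.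
apply: le_trans (ler_normD _ _) _; rewrite !normrZ.
rewrite ger0_norm ?subr_ge0// (ger0_norm t0).
apply: le_trans (_ : (1 - t) * r + t * r <= _).
  by apply: lerD; rewrite ler_wpM2l ?subr_ge0.
by rewrite -mulrDl subrK mul1r.
Qed.

Lemma is_derive_segment g (y d : 'rV[R]_n) (t : R) : B (g, y + t *: d) ->
  is_derive t 1 (fun s : R => G (g, y + s *: d)) (d *m jac2 (g, y + t *: d)).
Proof.
move=> Bt.
pose psi (s : R) : U * 'rV[R]_n := (g, y) + s *: (0 : U, d).
have psiE s : psi s = (g, y + s *: d).
  by rewrite /psi -[LHS]/(g + s *: 0, y + s *: d) scaler0 addr0.
have dpsi : is_derive t 1 psi (0, d).
  exact: is_derive_line.
have dd : is_diff (psi t) G ('d G (g, y + t *: d)).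
  by rewrite psiE; exact/differentiableP/smooth_differentiable.
rewrite -diff_jac2//; have := is_derive_comp_diff dpsi dd.
by congr (is_derive _ _ _ _); apply/funext => s /=; rewrite psiE.
Qed.

Lemma MVT_unit_segment (f df : R -> R) : (forall t : R, 0 <= t <= 1 -> is_derive t 1 f (df t)) ->
  exists2 c, 0 <= c <= 1 & f 1 - f 0 = df c.
Proof.
move=> fd; have [c] : exists2 c, c \in `[0, 1]%R & f 1 - f 0 = df c * (1 - 0).
  apply: MVT_segment => //.
    by move=> t; rewrite in_itv/= => /andP[/ltW ? /ltW ?]; apply: fd; apply/andP.
  by apply: derivable_within_continuous => t; rewrite in_itv/= => /fd[].
by rewrite in_itv/= subr0 mulr1 => ? ?; exists c.
Qed.

(** The mean value theorem along the segment from [y'] to [y], for the component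
    of [G] in the direction [y - y']. *)
Lemma strongly_monotone g y y' : `|g| < r -> `|y - p| <= r -> `|y' - p| <= r ->
  dotp ((G (g, y) - G (g, y')) *m Q) ((y - y') *m Q) <= - (mu / 2) * W (y - y').
Proof.
move=> gr yr yr'; set d := y - y'.
pose E := Q *m (d *m Q)^T.
have dE (u : 'rV[R]_n) : dotp (u *m Q) (d *m Q) = (u *m E) 0 0.
  by rewrite dotpE mulmxA.
have [|c c01] := @MVT_unit_segment (fun t => (G (g, y' + t *: d) *m E) 0 0)
                  (fun t => (d *m jac2 (g, y' + t *: d) *m E) 0 0).
  move=> t t01; apply: is_derive_coord.
  have [Bt _ _] := nbhdP gr (segment_ball t01 yr yr').
  have Ec : continuous (mulmxr E : 'rV[R]_n -> 'rV[R]_1) by exact: mulmxr_continuous.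
  apply: (@is_derive_comp_diff _ _ _ _ (mulmxr E) _ _ (mulmxr E) (is_derive_segment Bt)).
  by apply: DiffDef; [exact: linear_differentiable|rewrite diff_lin].
rewrite scale1r scale0r addr0 [y' + d]addrC subrK => H.
have [_ h _] := nbhdP gr (segment_ball c01 yr yr').
have subE (A C : 'M[R]_1) : (A - C) 0 0 = A 0 0 - C 0 0 by rewrite !mxE.
by rewrite dE mulmxBl subE H -dE.
Qed.

Lemma family_lipschitz g y y' : `|g| < r -> `|y - p| <= r -> `|y' - p| <= r ->
  `|G (g, y) - G (g, y')| <= K * `|y - y'|.
Proof.
move=> gr yr yr'; set d := y - y'.
apply: mx_norm_le; first by rewrite mulr_ge0 ?(ltW K0).
move=> i j; rewrite ord1.
have [|c c01] := @MVT_unit_segment (fun t => G (g, y' + t *: d) 0 j)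
                  (fun t => (d *m jac2 (g, y' + t *: d)) 0 j).
  move=> t t01; apply: is_derive_coord.
  have [Bt _ _] := nbhdP gr (segment_ball t01 yr yr').
  exact: is_derive_segment.
rewrite scale1r scale0r addr0 [y' + d]addrC subrK => H.
have [_ _ h] := nbhdP gr (segment_ball c01 yr yr').
rewrite !mxE H; apply: le_trans (h d); exact: coord_norm_le.
Qed.

Lemma quad_le0_eq0 v : W v <= 0 -> v = 0.
Proof.
have [a [b [a0 b0 abP]]] := dotp_norm_equiv Qfree.
have /andP[h _] := abP v; move/(le_trans h); rewrite pmulr_rle0// => {}h.
apply/eqP; rewrite -normr_eq0 -sqrf_eq0 eq_le h sqr_ge0//.
Qed.

Lemma zero_unique g y y' : `|g| < r -> `|y - p| <= r -> `|y' - p| <= r ->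
  G (g, y) = 0 -> G (g, y') = 0 -> y = y'.
Proof.
move=> gr yr yr' Gy Gy'; have := strongly_monotone gr yr yr'.
rewrite Gy Gy' subrr mul0mx dotp0l mulNr oppr_ge0 pmulr_rle0 ?divr_gt0// => h.
by apply/subr0_eq/quad_le0_eq0.
Qed.

Lemma jac2_unit g y : `|g| < r -> `|y - p| <= r -> jac2 (g, y) \in unitmx.
Proof.
move=> gr yr; have [_ h _] := nbhdP gr yr.
rewrite -row_free_unit; apply: inj_row_free => v vJ.
have := h v; rewrite vJ mul0mx dotp0l mulNr oppr_ge0 pmulr_rle0 ?divr_gt0//.
exact: quad_le0_eq0.
Qed.

(** Let [y0] minimize [|G (g, y) Q|^2] over the ball [W (y - p) <= rho ^+ 2], and
    suppose that [v = G (g, y0)] is nonzero. Moving from [y0] in the direction [v]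
    decreases the minimized function, since its derivative is
    [2 * dotp (v *m jac2 *m Q) (v *m Q) < 0]. The move is feasible: on the boundary
    of the ball the field points inwards, by monotonicity and the smallness of
    [G (g, p)]. This contradicts minimality. *)
Lemma zero_exists : exists2 r1, 0 < r1 & forall g, `|g| < r1 ->
  `|g| < r /\ exists2 y, `|y - p| <= r / 2 & G (g, y) = 0.
Proof.
have [a [b [a0 b0 abP]]] := dotp_norm_equiv Qfree.
(* This ball of the quadratic form lies in the ball of radius [r / 2], which
   leaves room for a ball around the zero inside the one of radius [r]. *)
pose rho := Num.sqrt a * (r / 2).
have rho0 : 0 < rho by rewrite mulr_gt0 ?sqrtr_gt0 ?divr_gt0.
have rho2 : rho ^+ 2 = a * (r / 2) ^+ 2 by rewrite exprMn sqr_sqrtr// ltW.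
clearbody rho.
have small : \forall g \near (0 : U), m%:R * `|G (g, p) *m Q| < mu / 2 * rho.
  have h : {for (0 : U), continuous (fun g => m%:R * `|G (g, p) *m Q|)}.
    move=> /=; apply: cvgM; first exact: cvg_cst.
    apply: cvg_norm.
    apply: (@continuous_comp _ _ _ (fun g => G (g, p)) (mulmx^~ Q)); last first.
      exact: mulmxr_continuous.
    apply: (@continuous_comp _ _ _ (fun g : U => (g, p)) G); last exact: smooth_continuous.
    by have := cvg_pair (@cvg_id _ (nbhs (0 : U))) (@cvg_cst _ p _ (nbhs (0 : U)) _); exact.
  apply: (h [set z | z < mu / 2 * rho]); rewrite /= Gp mul0mx normr0 mulr0.
  by apply: lt_nbhsl; rewrite mulr_gt0 ?divr_gt0.
have [r1 /= r10 r1P] := (nbhs_ballP _ _).1 small.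
exists (Num.min r1 r); first by rewrite lt_min r10.
move=> g; rewrite lt_min => /andP[gr1 gr]; split => //.
have {r1P small}small : m%:R * `|G (g, p) *m Q| < mu / 2 * rho.
  by apply: r1P; rewrite -ball_normE /= sub0r normrN.
pose S := [set y : 'rV[R]_n | W (y - p) <= rho ^+ 2].
have Sball y : S y -> `|y - p| <= r / 2.
  rewrite /S /= rho2 => Sy; have /andP[h _] := abP (y - p).
  have := le_trans h Sy; rewrite ler_pM2l// ler_pXn2r// ?nnegrE ?divr_ge0 ?(ltW r0)//.
have rr : r / 2 <= r by rewrite ler_pdivrMr// ler_peMr ?ler1n ?(ltW r0).
have SB y : S y -> `|y - p| <= r by move=> Sy; exact: le_trans (Sball _ Sy) rr.
have Wc := @quad_continuous R n m Q p.
have Sc : compact S.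
  apply: bounded_closed_compact.
    exists (`|p| + r / 2); split; first exact: num_real.
    move=> M hM y Sy; apply: le_trans (ltW hM).
    rewrite -[y](subrK p) addrC; apply: le_trans (ler_normD _ _) _.
    by rewrite lerD2l Sball.
  have -> : S = (fun y => W (y - p)) @^-1` [set z | z <= rho ^+ 2] by [].
  apply: preimage_closed.
    by move=> y _; exact: Wc.
  exact: closed_le.
pose N y := dotp (G (g, y) *m Q) (G (g, y) *m Q).
have [] := @EVT_min_rV R n N S _ Sc _.
- by exists p; rewrite /S /= subrr /W mul0mx dotp0l sqr_ge0.
- apply: continuous_in_subspaceT => y /set_mem Sy.
  apply: (@continuous_comp _ _ _ (fun y => G (g, y) *m Q) (fun u => dotp u u));
    last exact: dotp_continuous.
  apply: (@continuous_comp _ _ _ (fun y => G (g, y)) (mulmx^~ Q)); last exact: mulmxr_continuous.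
  apply: (@continuous_comp _ _ _ (fun y : 'rV[R]_n => (g, y)) G); last first.
    by apply: smooth_continuous; have [] := nbhdP gr (SB _ Sy).
  by have := cvg_pair (@cvg_cst _ g _ (nbhs y) _) (@cvg_id _ (nbhs y)); exact.
move=> y0 /set_mem Sy0 ymin; exists y0; first exact: Sball.
set v := G (g, y0).
apply/eqP; apply: contraT => v0.
have Wv : 0 < W v.
  by rewrite ltNge; apply/negP => /quad_le0_eq0/eqP; rewrite (negbTE v0).
have [By0 hy0 _] := nbhdP gr (SB _ Sy0).
have Ndec : \forall h \near 0^'+, N (y0 + h *: v) < N y0.
  have D : is_derive (0 : R) 1 (fun s : R => N (y0 + s *: v))
      (2 * dotp (v *m jac2 (g, y0) *m Q) (v *m Q)).
    have := @is_derive_segment g y0 v 0; rewrite scale0r addr0 => /(_ By0) h.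
    have := is_derive_dotp Q 0 h; rewrite scale0r addr0 subr0.
    by under eq_fun do rewrite subr0.
  have := derive_lt0_right D; rewrite scale0r addr0.
  under eq_near do rewrite addr0.
  apply; rewrite pmulr_rlt0//; apply: le_lt_trans (hy0 v) _.
  by rewrite mulNr oppr_lt0 mulr_gt0 ?divr_gt0.
have Sin : \forall h \near 0^'+, S (y0 + h *: v).
  have D := is_derive_dotp Q p (is_derive_line y0 v 0).
  rewrite scale0r addr0 in D.
  have [E|ne] := eqVneq (W (y0 - p)) (rho ^+ 2).
    have d0 : 2 * dotp (v *m Q) ((y0 - p) *m Q) < 0.
      rewrite pmulr_rlt0//.
      have -> : v *m Q = (v - G (g, p)) *m Q + G (g, p) *m Q by rewrite -mulmxDl subrK.
      have pr : `|p - p| <= r by rewrite subrr normr0 ltW.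
      rewrite dotpDl; have := strongly_monotone gr (SB _ Sy0) pr; rewrite -/v E => h1.
      have h2 : `|(y0 - p) *m Q| <= rho.
        rewrite -(@ler_pXn2r _ 2)// ?nnegrE ?(ltW rho0)//.
        by rewrite -E; exact: sqr_norm_le_dotp.
      have h3 : dotp (G (g, p) *m Q) ((y0 - p) *m Q) < mu / 2 * rho ^+ 2.
        apply: le_lt_trans (ler_norm _) _; apply: le_lt_trans (dotp_le _ _) _.
        apply: (@le_lt_trans _ _ (m%:R * `|G (g, p) *m Q| * rho)).
          by rewrite ler_wpM2l// mulr_ge0.
        by rewrite expr2 mulrA ltr_pM2r.
      by have := ler_ltD h1 h3; rewrite mulNr addNr.
    have := derive_lt0_right D d0; apply: filterS => h.
    by rewrite addr0 scale0r addr0 -[X in _ < X]/(W (y0 - p)) E => /ltW.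
  have lt0 : W (y0 - p) < rho ^+ 2 by rewrite lt_neqAle ne.
  have Dc : {for 0, continuous (fun s : R => W (y0 + s *: v - p))}.
    by case: D => /derivable1_diffP/differentiable_continuous.
  have : \forall h \near (0 : R), W (y0 + h *: v - p) < rho ^+ 2.
    apply: (Dc [set z | z < rho ^+ 2]).
    by rewrite scale0r addr0; exact: lt_nbhsl.
  by move=> H; apply: cvg_within; apply: filterS H => h /ltW.
have [h [Nh Sh]] : exists h : R, N (y0 + h *: v) < N y0 /\ S (y0 + h *: v).
  by near (0 : R)^'+ => h; exists h; split; near: h.
by have := ymin _ (mem_set Sh); rewrite leNgt Nh.
Unshelve. all: by end_near. Qed.

Variables (r1 : R) (X : U -> 'rV[R]_n).
Hypotheses (r10 : 0 < r1).
Hypothesis XP : forall g, `|g| < r1 -> [/\ `|g| < r, `|X g - p| <= r & G (g, X g) = 0].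

(** Monotonicity at [h + g] compares [X (h + g)], where the field vanishes, with
    [X g], where it is of the order of [h]. *)
Lemma zero_lipschitz g : `|g| < r1 -> exists2 C, 0 < C &
  \forall h \near (0 : U), `|X (h + g) - X g| <= C * `|h|.
Proof.
move=> gr1; have [gr yr Gy] := XP gr1; set y := X g in yr Gy *.
have [Bz _ _] := nbhdP gr yr; have dGz := smooth_differentiable Bz.
have [k k0 kP] := linear_lipschitz (diff_continuous dGz).
have [a [b [a0 b0 abP]]] := dotp_norm_equiv Qfree.
(* Monotonicity bounds the displacement by [c] times the value of the field at
   [X g] for the parameter [h + g], itself at most [(k + 1) * `|h|]. *)
pose c := m%:R * (n%:R * `|Q|) ^+ 2 / (mu / 2 * a).
have c0 : 0 <= c.
  apply: divr_ge0; first by rewrite mulr_ge0 ?sqr_ge0.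
  by rewrite mulr_ge0 ?(ltW a0)// divr_ge0 ?(ltW mu0).
exists (c * (k + 1) + 1); first by rewrite ltr_wpDl// mulr_ge0// addr_ge0// ltW.
have [s /= s0 sP] := (nbhs_ballP _ _).1 (diff_bound dGz ltr01).
have [s' /= s'0 s'P] : exists2 s' : R, 0 < s' & forall h, `|h| < s' -> `|h + g| < r1.
  exists (r1 - `|g|); first by rewrite subr_gt0.
  by move=> h; rewrite ltrBrDr; apply: le_lt_trans; exact: ler_normD.
apply/nbhs_ballP; exists (Num.min s s'); first by rewrite /= lt_min s0.
move=> h; rewrite -ball_normE /= sub0r normrN lt_min => /andP[hs hs'].
have [hgr hyr Gh] := XP (s'P _ hs'); set d := X (h + g) - y.
have Gle : `|G (h + g, y)| <= (k + 1) * `|h|.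
  have nh : `|(h, 0 : 'rV[R]_n)| = `|h| by rewrite prod_normE/= normr0 max_l.
  have := sP (h, 0); rewrite -ball_normE /= sub0r normrN nh => /(_ hs).
  rewrite -[(h, 0) + (g, y)]/(h + g, 0 + y) add0r Gy add0r mul1r => H.
  have := kP (h, 0); rewrite nh => H'.
  rewrite mulrDl mul1r -(subrK ('d G (g, y) (h, 0)) (G (h + g, y))) addrC.
  by apply: le_trans (ler_normD _ _) _; rewrite lerD.
apply: (@le_trans _ _ (c * `|G (h + g, y)|)); last first.
  apply: le_trans (_ : c * ((k + 1) * `|h|) <= _); first by rewrite ler_wpM2l.
  by rewrite mulrA ler_wpM2r// lerDl.
have [->|d0] := eqVneq d 0; first by rewrite normr0 mulr_ge0.
have nd0 : 0 < `|d| by rewrite normr_gt0.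
rewrite /c mulrAC ler_pdivlMr ?mulr_gt0 ?divr_gt0// -(ler_pM2r nd0).
have := strongly_monotone hgr hyr yr; rewrite Gh sub0r mulNmx dotpNl -/d mulNr lerN2 => H.
have /andP[H' _] := abP d.
apply: (@le_trans _ _ (mu / 2 * W d)).
  have -> : `|d| * (mu / 2 * a) * `|d| = mu / 2 * (a * `|d| ^+ 2) by ring.
  by rewrite ler_wpM2l// divr_ge0// ltW.
apply: le_trans H _; apply: le_trans (ler_norm _) _; apply: le_trans (dotp_le _ _) _.
have -> : m%:R * (n%:R * `|Q|) ^+ 2 * `|G (h + g, y)| * `|d| =
  m%:R * (n%:R * `|Q| * `|G (h + g, y)|) * (n%:R * `|Q| * `|d|) by ring.
by apply: ler_pM; rewrite ?mulr_ge0 ?ler_wpM2l ?norm_mulmx_le.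
Qed.

(** Expanding [G (h + g, X (h + g)) = 0] at [(g, X g)] and solving for the
    displacement; the remainder is [o(h)] by [zero_lipschitz]. *)
Lemma zero_diff g : `|g| < r1 ->
  is_diff g X (fun h => - 'd G (g, X g) (h, 0) *m invmx (jac2 (g, X g))).
Proof.
move=> gr1; have [gr yr Gy] := XP gr1.
have [C C0 XC] := zero_lipschitz gr1.
set y := X g in yr Gy XC *.
have [Bz _ _] := nbhdP gr yr; have dGz := smooth_differentiable Bz.
set J := jac2 (g, y); have Ju : J \in unitmx by exact: jac2_unit.
pose L0 (h : U) := - 'd G (g, y) (h, 0) *m invmx J.
have L0lin : linear L0.
  move=> c u v; rewrite /L0.
  have -> : (c *: u + v, 0 : 'rV[R]_n) = c *: (u, 0) + (v, 0).
    by rewrite -[RHS]/(c *: u + v, c *: 0 + 0) scaler0 addr0.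
  by rewrite linearP opprD mulmxDl scalemxAl scalerN.
pose L : {linear U -> 'rV[R]_n} := HB.pack L0 (GRing.isLinear.Build _ _ _ _ L0 L0lin).
have Lc : continuous L.
  move=> h; apply: (@continuous_comp _ _ _ (fun h => - 'd G (g, y) (h, 0)) (mulmx^~ (invmx J)));
    last exact: mulmxr_continuous.
  apply: (@cvgN _ _ _ (nbhs h)).
  apply: (@continuous_comp _ _ _ (fun h : U => (h, 0 : 'rV[R]_n)) ('d G (g, y)));
    last exact: diff_continuous.
  by have := cvg_pair (@cvg_id _ (nbhs h)) (@cvg_cst _ (0 : 'rV[R]_n) _ (nbhs h) _); exact.
apply: (is_diff_bound Lc) => e e0.
pose e' := e / (n%:R * `|invmx J| * (1 + C) + 1).
have den0 : 0 < n%:R * `|invmx J| * (1 + C) + 1.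
  by rewrite ltr_wpDl ?mulr_ge0 ?addr_ge0// ltW.
have e'0 : 0 < e' by rewrite divr_gt0.
have [s /= s0 sP] := (nbhs_ballP _ _).1 (diff_bound dGz e'0).
have [s' /= s'0 s'P] : exists2 s' : R, 0 < s' & forall h, `|h| < s' -> `|h + g| < r1.
  exists (r1 - `|g|); first by rewrite subr_gt0.
  by move=> h; rewrite ltrBrDr; apply: le_lt_trans; exact: ler_normD.
have C1 : 0 < 1 + C by rewrite addr_gt0.
have near_s : \forall h \near (0 : U), `|h| < Num.min (s / (1 + C)) s'.
  apply/nbhs_ballP; exists (Num.min (s / (1 + C)) s'); first by rewrite /= lt_min divr_gt0.
  by move=> h; rewrite -ball_normE /= sub0r normrN.
near=> h.
have /andP[hs hs'] : (`|h| < s / (1 + C)) && (`|h| < s').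
  by rewrite -lt_min; near: h.
have dC : `|X (h + g) - y| <= C * `|h| by near: h.
have [hgr hyr Gh] := XP (s'P _ hs'); set d := X (h + g) - y in dC.
have wle : `|(h, d)| <= (1 + C) * `|h|.
  rewrite prod_normE/= ge_max mulrDl mul1r lerDl mulr_ge0 ?(ltW C0)//=.
  by apply: le_trans dC _; rewrite lerDr.
have := sP (h, d); rewrite -ball_normE /= sub0r normrN.
have -> : `|(h, d)| < s by apply: le_lt_trans wle _; rewrite mulrC -ltr_pdivlMr.
rewrite -[(h, d) + (g, y)]/(h + g, d + y) subrK Gh Gy !add0r normrN => /(_ isT) H.
have dGE : 'd G (g, y) (h, d) = 'd G (g, y) (h, 0) + d *m J.
  have -> : (h, d) = (h, 0) + (0, d) by rewrite -[RHS]/(h + 0, 0 + d) addr0 add0r.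
  by rewrite linearD diff_jac2.
have -> : X (h + g) - (y + L h) = 'd G (g, y) (h, d) *m invmx J.
  by rewrite dGE mulmxDl mulmxK// opprD addrA -/d -[L h]/(L0 h) /L0 mulNmx opprK addrC.
apply: le_trans (norm_mulmx_le _ _) _.
apply: le_trans (_ : n%:R * `|invmx J| * (e' * ((1 + C) * `|h|)) <= _).
  rewrite ler_wpM2l ?mulr_ge0//; apply: le_trans H _.
  by rewrite ler_wpM2l// ltW.
rewrite /e'.
have -> : n%:R * `|invmx J| * (e / (n%:R * `|invmx J| * (1 + C) + 1) * ((1 + C) * `|h|)) =
  (n%:R * `|invmx J| * (1 + C)) / (n%:R * `|invmx J| * (1 + C) + 1) * (e * `|h|).
  by field; rewrite gt_eqF.
rewrite ler_piMl// ?mulr_ge0// ?(ltW e0)// ler_pdivrMr// mul1r lerDl//.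
Unshelve. all: by end_near. Qed.

(** If [X] is of class C^k, so is its derivative, by the formula of [zero_diff]. *)
Lemma zero_smooth : smooth_on [set g | `|g| < r1] X.
Proof.
pose A := [set g : U | `|g| < r1].
have oA : open A.
  have -> : A = ball (0 : U) r1.
    by apply/seteqP; split => g; rewrite -ball_normE /A /= sub0r normrN.
  exact: ball_open.
have AB g : A g -> B (g, X g) by move=> /XP[gr yr _]; have [] := nbhdP gr yr.
have dX g : A g -> differentiable X g by move=> /zero_diff[].
elim=> [|k IH]; first by move=> g /set_mem /dX /differentiable_continuous.
split=> // v.
apply: (@Ck_ext _ _ _ _ A (fun g => - 'D_(v, 0) G (g, X g) *m invmx (jac2 (g, X g)))) => //.
  by move=> g Ag; rewrite (derive_diffE v (zero_diff Ag)) deriveE//; exact/smooth_differentiable/AB.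
apply: Ck_mulmx => //.
  apply/Ck_mxP => // i j.
  apply: (@Ck_ext _ _ _ _ _ (fun g => -1 * ('D_(v, 0) G (g, X g)) i j)) => //.
    by move=> g _; rewrite mulN1r mxE.
  apply: CkM => //; first exact: Ck_cst.
  apply: (Ck_comp_pair (H := fun z => ('D_(v, 0) G z) i j) oA AB) => //.
  by have [_ /(_ (v, 0)) D] := smG k.+1; exact: ((Ck_mxP _ _ oB).1 D i j).
apply: Ck_invmx => //.
  by move=> g /XP[gr yr _]; exact: jac2_unit.
apply/Ck_mxP => // i j.
apply: (Ck_comp_pair (H := fun z => (jac2 z) i j) oA AB) => //.
exact: ((Ck_mxP _ _ oB).1 (Ck_jac2 k) i j).
Qed.

End ParametricZero.

(** * Solutions and unstable modes in Euclidean space *)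

Section ChartDynamics.
Context {R : realType}.

(** A ball of the sup norm is a product of segments, so truncating each coordinate
    retracts onto it and is 1-Lipschitz for that norm. *)
Definition clamp n (p : 'rV[R]_n) (r : R) (y : 'rV[R]_n) : 'rV[R]_n :=
  \row_j (p 0 j + Num.max (- r) (Num.min r (y 0 j - p 0 j))).

Lemma clamp_lipschitz n (p : 'rV[R]_n) r x y : `|clamp p r x - clamp p r y| <= `|x - y|.
Proof.
apply: mx_norm_le => // i j; rewrite !mxE opprD addrACA subrr add0r.
have := coord_norm_le (x - y) 0 j; rewrite !mxE; apply: le_trans.
have -> : x 0 j - y 0 j = (x 0 j - p 0 j) - (y 0 j - p 0 j) by ring.
move: (x 0 j - p 0 j) (y 0 j - p 0 j) => u v {i j}.
have nuv : u - v <= `|u - v| by exact: ler_norm.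
have nvu : v - u <= `|u - v| by rewrite distrC; exact: ler_norm.
rewrite ler_norml /Num.max /Num.min; apply/andP.
by case: (ltP r u); case: (ltP r v) => ? ?; do ?case: ltP => ? ; split; lra.
Qed.

Lemma clamp_ball n (p : 'rV[R]_n) r y : 0 <= r -> `|clamp p r y - p| <= r.
Proof.
move=> r0; apply: mx_norm_le => // i j; rewrite ord1 !mxE [p 0 j + _]addrC addrK.
rewrite ler_norml le_max lexx ge_max ge_min lexx/= andbT.
by rewrite (le_trans _ r0)// oppr_le0.
Qed.

Lemma clamp_id n (p : 'rV[R]_n) r y : `|y - p| <= r -> clamp p r y = y.
Proof.
move=> yr; apply/matrixP => i j; rewrite ord1 !mxE.
have := le_trans (coord_norm_le (y - p) 0 j) yr; rewrite !mxE ler_norml => /andP[h1 h2].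
by rewrite min_r// max_r// addrC subrK.
Qed.

(** The truncated field [F \o clamp p r] is globally Lipschitz, so it has global
    solutions; they are trapped in a sublevel set of [W], where the truncation
    does nothing. *)
Lemma box_solution n m (F : 'rV[R]_n -> 'rV[R]_n) (p c q : 'rV[R]_n) (r K mu rho : R)
    (Q : 'M[R]_(n, m)) (W := fun v : 'rV[R]_n => dotp (v *m Q) (v *m Q)) :
  0 < r -> 0 < K -> 0 <= mu ->
  (forall x y, `|x - p| <= r -> `|y - p| <= r -> `|F x - F y| <= K * `|x - y|) ->
  (forall y, `|y - p| <= r ->
     dotp (F y *m Q) ((y - c) *m Q) <= - (mu / 2) * W (y - c)) ->
  (forall y, W (y - c) <= rho -> `|y - p| <= r) ->
  W (q - c) < rho ->
  exists y : R -> 'rV[R]_n, [/\ y 0 = q, continuous y,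
    forall t : R, 0 <= t -> W (y t - c) <= rho &
    forall t : R, 0 < t -> is_derive t 1 y (F (y t))].
Proof.
move=> r0 K0 mu0 FL Fdec Wr Wq.
have FcL x y : `|F (clamp p r x) - F (clamp p r y)| <= K * `|x - y|.
  apply: le_trans (FL _ _ (clamp_ball _ _ (ltW r0)) (clamp_ball _ _ (ltW r0))) _.
  by rewrite ler_wpM2l ?(ltW K0)// clamp_lipschitz.
have [y [y0 yc yd]] := picard_lindelof K0 FcL q.
have wc := @quad_continuous R n m Q c.
have Wy (t : R) : 0 <= t -> W (y t - c) <= rho.
  move=> t0; have := @sublevel_trapping R _ y setT (fun z => W (z - c)) rho mu.
  move=> /(_ openT (fun z _ => wc z)).
  have cK : closed (setT `&` [set z | W (z - c) <= rho]).
    rewrite setTI.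
    have -> : [set z | W (z - c) <= rho] = (fun z => W (z - c)) @^-1` [set z | z <= rho] by [].
    by apply: preimage_closed; [move=> z _; exact: wc|exact: closed_le].
  move=> /(_ cK mu0 (fun z _ => dotp_ge0 _) (continuous_subspaceT yc) I).
  rewrite y0 => /(_ Wq) H.
  have [|_ h] := H _ t t0.
    move=> s s0 _ Ws; exists (2 * dotp (F (y s) *m Q) ((y s - c) *m Q)).
      have := yd s s0; rewrite clamp_id; last exact: Wr.
      exact: is_derive_dotp.
    have := Fdec _ (Wr _ Ws); rewrite -(@ler_pM2l _ 2)// => /le_trans; apply.
    by rewrite mulrA mulrN mulrCA divff// mulr1.
  apply: le_trans h _; apply: le_trans (ltW Wq).
  by rewrite ler_piMl ?dotp_ge0// -expR0 ler_expR oppr_le0 mulr_ge0.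
exists y; split=> // t t0; have := yd t t0.
by rewrite clamp_id//; apply/Wr/Wy/ltW.
Qed.

(** Let [S z = (z l1)^2 + (z l2)^2], the squared modulus of the functional
    [l1 + i l2]. For the linearized equation its derivative along solutions is
    [2 * a * S >= 0], so for the equation itself it decreases only through the
    remainder of the linearization, which is arbitrarily small compared with the
    square of the initial distance [eta]. But the exponential estimate forces
    [S] to drop by more than half within a time [T] that does not depend on
    [eta]. *)
Lemma stable_no_unstable_mode n (G : 'rV[R]_n -> 'rV[R]_n) (p : 'rV[R]_n)
    (A : 'M[R]_n) (C lam delta : R) :
  G p = 0 -> is_diff p G (mulmx^~ A) ->
  0 < C -> 0 < lam -> 0 < delta ->
  (forall q, `|q - p| < delta -> exists y : R -> 'rV[R]_n,
     [/\ y 0 = q, {within [set t : R | 0 <= t], continuous y},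
        forall t : R, 0 < t -> is_derive t 1 y (G (y t)) &
        forall t : R, 0 <= t ->
          `|y t - p| <= C * expR (- (lam * t)) * `|q - p|]) ->
  forall (a b : R) (l1 l2 : 'cV[R]_n),
     A *m l1 = a *: l1 - b *: l2 -> A *m l2 = b *: l1 + a *: l2 -> 0 <= a ->
     l1 = 0 /\ l2 = 0.
Proof.
move=> Gp dG C0 lam0 delta0 sol a b l1 l2 Al1 Al2 a0.
pose Q : 'M[R]_(n, 1 + 1) := row_mx l1 l2.
pose S (z : 'rV[R]_n) := dotp (z *m Q) (z *m Q).
have dotQ u v : dotp (u *m Q) (v *m Q) =
    (u *m l1) 0 0 * (v *m l1) 0 0 + (u *m l2) 0 0 * (v *m l2) 0 0.
  rewrite /dotp big_split_ord/= !big_ord1 /Q !mul_mx_row.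
  by rewrite !row_mxEl !row_mxEr.
have SA z : 0 <= dotp (z *m A *m Q) (z *m Q).
  rewrite dotQ -!mulmxA Al1 Al2 mulmxBr mulmxDr -!scalemxAr.
  have subE (X Y : 'M[R]_1) : (X - Y) 0 0 = X 0 0 - Y 0 0 by rewrite !mxE.
  have addE (X Y : 'M[R]_1) : (X + Y) 0 0 = X 0 0 + Y 0 0 by rewrite !mxE.
  have scE k (X : 'M[R]_1) : (k *: X) 0 0 = k * X 0 0 by rewrite !mxE.
  rewrite subE addE !scE; set s1 := (z *m l1) 0 0; set s2 := (z *m l2) 0 0.
  have -> : (a * s1 - b * s2) * s1 + (b * s1 + a * s2) * s2 = a * (s1 ^+ 2 + s2 ^+ 2) by ring.
  by rewrite mulr_ge0// addr_ge0 ?sqr_ge0.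
apply: contrapT => nl.
have [i Si] : exists i, 0 < S (delta_mx 0 i).
  apply: contrapT => nS; apply: nl.
  have H i : l1 i 0 = 0 /\ l2 i 0 = 0.
    have : S (delta_mx 0 i) <= 0 by rewrite leNgt; apply/negP => h; apply: nS; exists i.
    rewrite /S dotQ -!expr2 -!rowE !mxE => h.
    have := sqr_ge0 (l1 i 0); have := sqr_ge0 (l2 i 0) => h1 h2.
    split; apply/eqP; rewrite -sqrf_eq0; apply/eqP; lra.
  by split; apply/matrixP => k l; rewrite ord1 mxE; have [] := H k.
set sigma := S (delta_mx 0 i) in Si.
pose N := (1 + 1)%:R * (n%:R * `|Q|) ^+ 2 + 1 : R.
have N0 : 0 < N by rewrite ltr_wpDl ?mulr_ge0 ?sqr_ge0.
have SN u v : `|dotp (u *m Q) (v *m Q)| <= N * (`|u| * `|v|).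
  apply: le_trans (dotp_le _ _) _.
  apply: (@le_trans _ _ ((1 + 1)%:R * (n%:R * `|Q| * `|u|) * (n%:R * `|Q| * `|v|))).
    by apply: ler_pM; rewrite ?mulr_ge0// ?ler_wpM2l// norm_mulmx_le.
  rewrite (_ : _ * _ * _ = (1 + 1)%:R * (n%:R * `|Q|) ^+ 2 * (`|u| * `|v|)); last by ring.
  by rewrite ler_wpM2r ?mulr_ge0// lerDl.
clearbody N.
(* At time [T] the exponential estimate leaves less than half of [S] at time 0;
   [eps] is so small that the remainder consumes at most a quarter of it. *)
pose T := N * C ^+ 2 / (lam * sigma) + 1.
have T0 : 0 < T by rewrite ltr_wpDl// divr_ge0// ?mulr_ge0 ?sqr_ge0 ?ltW// mulr_gt0.
have C2 : 0 < C ^+ 2 by rewrite exprn_gt0.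
pose eps := sigma / (8 * N * C ^+ 2 * T).
have eps0 : 0 < eps by rewrite divr_gt0// !mulr_gt0.
have [s /= s0 sP] : exists2 s : R, 0 < s & forall y, `|y - p| < s ->
    `|G y - (y - p) *m A| <= eps * `|y - p|.
  have [dGp dE] := dG.
  have [s /= s0 sP] := (nbhs_ballP _ _).1 (diff_bound dGp eps0).
  exists s => // y ys; have := sP (y - p).
  by rewrite -ball_normE /= sub0r normrN subrK Gp add0r dE; apply.
(* The solution starting at distance [eta] remains in the ball of radius [s]. *)
pose eta := Num.min (delta / 2) (s / (2 * C)).
have eta0 : 0 < eta by rewrite lt_min !divr_gt0 ?mulr_gt0.
have nq : `|p + eta *: delta_mx 0 i - p| <= eta.
  rewrite addrC addKr normrZ ger0_norm ?(ltW eta0)// ler_piMr ?(ltW eta0)//.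
  by apply: mx_norm_le => // k l; rewrite mxE ger0_norm ?ler0n// lern1 leq_b1.
have [|y [y0 yc yd yb]] := sol (p + eta *: delta_mx 0 i).
  apply: le_lt_trans nq _; rewrite gt_min; apply/orP; left.
  by rewrite ltr_pdivrMr// ltr_pMr// ltr1n.
have yCe (t : R) : 0 <= t -> `|y t - p| <= C * eta.
  move=> t0; apply: le_trans (yb t t0) _; apply: ler_pM => //.
    by rewrite mulr_ge0 ?(ltW C0)// expR_ge0.
  by rewrite ler_piMr ?(ltW C0)// -expR0 ler_expR oppr_le0 mulr_ge0// ltW.
have Ces : C * eta < s.
  have : eta <= s / (2 * C) by rewrite ge_min lexx orbT.
  rewrite ler_pdivlMr ?mulr_gt0// => h; have : 0 < C * eta by rewrite mulr_gt0.
  by move: h; rewrite mulrCA [eta * C]mulrC; lra.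
pose w (t : R) := S (y t - p).
pose dw (t : R) := 2 * dotp (G (y t) *m Q) ((y t - p) *m Q).
have wd (t : R) : 0 < t -> is_derive t 1 w (dw t).
  by move=> t0; exact: (is_derive_dotp Q p (yd t t0)).
have dwge (t : R) : 0 < t -> - (2 * N * eps * (C * eta) ^+ 2) <= dw t.
  move=> t0; rewrite /dw.
  have yt := yCe t (ltW t0).
  have := sP (y t) (le_lt_trans yt Ces) => h.
  have -> : G (y t) = (y t - p) *m A + (G (y t) - (y t - p) *m A) by rewrite addrC subrK.
  rewrite mulmxDl dotpDl mulrDr; have := SA (y t - p).
  have := SN (G (y t) - (y t - p) *m A) (y t - p); rewrite ler_norml => /andP[h1 _] h2.
  have h3 : N * (`|G (y t) - (y t - p) *m A| * `|y t - p|) <= N * eps * (C * eta) ^+ 2.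
    rewrite -[leRHS]mulrA ler_wpM2l ?(ltW N0)//.
    apply: (@le_trans _ _ (eps * `|y t - p| * `|y t - p|)); first by rewrite ler_wpM2r.
    by rewrite -mulrA ler_wpM2l ?(ltW eps0)// expr2 ler_pM.
  lra.
have wc : {within `[0, T], continuous w}.
  apply: continuous_subspaceW (_ : {within [set t : R | 0 <= t], continuous w}).
    by move=> t; rewrite /= in_itv/= => /andP[].
  move=> t; apply: (@continuous_comp _ _ _ (y : subspace _ -> _) (fun z => S (z - p)));
    first exact: yc.
  exact: quad_continuous.
have wdT (t : R) : t \in `]0, T[%R -> is_derive t 1 w (dw t).
  by rewrite in_itv/= => /andP[+ _]; exact: wd.
have [t tT] := MVT T0 wdT wc.
move: tT; rewrite in_itv/= subr0 => /andP[t0 tT] E.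
have wT : w T <= N * (C ^+ 2 * expR (- (lam * T)) ^+ 2 * eta ^+ 2).
  apply: le_trans (ler_norm _) _; apply: le_trans (SN _ _) _.
  rewrite ler_wpM2l ?(ltW N0)// -!exprMn -expr2 ler_pXn2r ?nnegrE//.
    apply: le_trans (yb T (ltW T0)) _; rewrite ler_wpM2l//.
    by rewrite mulr_ge0 ?expR_ge0// ltW.
  by rewrite mulr_ge0 ?(ltW eta0)// mulr_ge0 ?expR_ge0// ltW.
have w0 : w 0 = eta ^+ 2 * sigma.
  rewrite /w y0 addrC addKr /S -!scalemxAl /sigma /S /dotp mulr_sumr.
  by apply: eq_bigr => k _; rewrite !mxE; ring.
have expT : N * C ^+ 2 * expR (- (lam * T)) ^+ 2 < sigma / 2.
  have h1 : 1 + 2 * (lam * T) <= expR (lam * T) ^+ 2.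
    by rewrite -expRM_natl; exact: expR_ge1Dx.
  have h2 : 0 < 1 + 2 * (lam * T) by rewrite addr_gt0 ?mulr_gt0.
  rewrite expRN exprVn ltr_pdivrMr ?exprn_gt0 ?expR_gt0//.
  apply: lt_le_trans (_ : sigma / 2 * (1 + 2 * (lam * T)) <= _); last first.
    by rewrite ler_wpM2l// divr_ge0// ltW.
  have -> : sigma / 2 * (1 + 2 * (lam * T)) = N * C ^+ 2 + (sigma / 2 + sigma * lam).
    by rewrite /T; field; rewrite !gt_eqF.
  by rewrite ltrDl addr_gt0 ?divr_gt0 ?mulr_gt0.
have := dwge t t0; have dT : dw t * T = w T - w 0 by [].
move=> h; have : - (2 * N * eps * (C * eta) ^+ 2) * T <= w T - w 0.
  by rewrite -dT ler_wpM2r// ltW.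
have -> : - (2 * N * eps * (C * eta) ^+ 2) * T = - (eta ^+ 2 * (sigma / 4)).
  by rewrite /eps; field; rewrite !gt_eqF.
have e2 : 0 < eta ^+ 2 by rewrite exprn_gt0.
have : w T < eta ^+ 2 * (sigma / 2).
  apply: le_lt_trans wT _.
  by rewrite mulrA mulrA mulrC ltr_pM2l.
have es : 0 < eta ^+ 2 * sigma by rewrite mulr_gt0.
rewrite w0; lra.
Qed.

End ChartDynamics.

(** * Vector fields and solutions in charts *)

Section Charts.
Context {R : realType} {n : nat} (M : smoothManifold R n).
Implicit Types (c : chart R n M) (x : M) (A : set M) (J : M -> R).

Lemma chart_invP c y : (chart_map c @` chart_dom c) y ->
  chart_dom c (chart_inv c y) /\ chart_map c (chart_inv c y) = y.
Proof. by move=> [x cx <-]; rewrite chart_mapK ?inE. Qed.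

Lemma chart_inv_at c y : (chart_map c @` chart_dom c) y ->
  {for y, continuous (chart_inv c)}.
Proof. by move=> cy; apply: chart_inv_continuous; rewrite inE. Qed.

Lemma chart_map_at c x : chart_dom c x -> {for x, continuous (chart_map c)}.
Proof. by move=> cx; apply: chart_map_continuous; rewrite inE. Qed.

Lemma chart_imageP c A y : (chart_map c @` (chart_dom c `&` A)) y <->
  (chart_map c @` chart_dom c) y /\ A (chart_inv c y).
Proof.
split=> [[x [cx Ax] <-]|[cy Ay]].
  by rewrite chart_mapK ?inE//; split=> //; exists x.
by have [h1 h2] := chart_invP cy; exists (chart_inv c y).
Qed.

Lemma open_chart_image c A : open A -> open (chart_map c @` (chart_dom c `&` A)).
Proof.
move=> oA; rewrite openE => y /chart_imageP[cy Ay].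
have h1 : \forall z \near y, (chart_map c @` chart_dom c) z.
  by apply: open_nbhs_nbhs; split => //; exact: chart_img_open.
have h2 : \forall z \near y, A (chart_inv c z).
  by apply: (chart_inv_at cy); apply: open_nbhs_nbhs; split.
by near=> z; apply/chart_imageP; split; near: z.
Unshelve. all: by end_near. Qed.

Lemma atlas_chart_at x : atlas (chart_at x).
Proof. by rewrite /chart_at; case: cid2. Qed.

Lemma chart_dom_chart_at x : chart_dom (chart_at x) x.
Proof. by rewrite /chart_at; case: cid2. Qed.

Lemma transition_differentiable c c' x : atlas c -> atlas c' ->
  chart_dom c x -> chart_dom c' x ->
  differentiable (chart_map c' \o chart_inv c) (chart_map c x).
Proof.
move=> ac ac' cx c'x; have [h _] := atlas_smooth ac ac' 1.
by apply: h; exists x.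
Qed.

Lemma near_chart_image c A x : chart_dom c x -> open A -> A x ->
  \forall y \near chart_map c x, (chart_map c @` chart_dom c) y /\ A (chart_inv c y).
Proof.
move=> cx oA Ax; have : (chart_map c @` (chart_dom c `&` A)) (chart_map c x) by exists x.
move=> h; have := open_nbhs_nbhs (conj (open_chart_image (c := c) oA) h).
by apply: filterS => y /chart_imageP.
Qed.

(** The two transition maps are inverse to each other near the point, so their
    differentials are too. *)
Lemma transitionK c c' x (v : 'rV[R]_n) : atlas c -> atlas c' ->
  chart_dom c x -> chart_dom c' x ->
  'd (chart_map c \o chart_inv c') (chart_map c' x)
    ('d (chart_map c' \o chart_inv c) (chart_map c x) v) = v.
Proof.
move=> ac ac' cx c'x.
have d1 := transition_differentiable ac ac' cx c'x.
have d2 := transition_differentiable ac' ac c'x cx.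
have E : (chart_map c' \o chart_inv c) (chart_map c x) = chart_map c' x.
  by rewrite /= chart_mapK ?inE.
have d2' : differentiable (chart_map c \o chart_inv c')
    ((chart_map c' \o chart_inv c) (chart_map c x)).
  by rewrite E.
have := diff_comp d1 d2'; rewrite E => /(congr1 (fun f => f v)) /= <-.
set g := (X in 'd X _ _).
have gid : \forall y \near chart_map c x, id y = g y.
  have := near_chart_image cx (chart_dom_open c') c'x.
  apply: filterS => y [cy c'y]; rewrite /g /= chart_mapK ?inE//.
  by have [] := chart_invP cy.
have [dI dIE] := is_diff_id (chart_map c x).
by have [_ ->] := near_eq_diff gid dI; rewrite dIE.
Qed.

Lemma coordsK c x (v : tangent x) : atlas c -> chart_dom c x ->
  'd (chart_map (chart_at x) \o chart_inv c) (chart_map c x) (coords c v) = v.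
Proof.
by move=> ac cx; apply: transitionK => //; [exact: atlas_chart_at|exact: chart_dom_chart_at].
Qed.

Lemma coords_eq0 c x (v : tangent x) : atlas c -> chart_dom c x ->
  coords c v = 0 -> v = 0.
Proof. by move=> ac cx v0; rewrite -(coordsK v ac cx) v0 linear0. Qed.

Lemma smooth_function_diff c J x : smooth_function J -> atlas c -> chart_dom c x ->
  differentiable (J \o chart_inv c) (chart_map c x).
Proof. by move=> sJ ac cx; have [h _] := sJ c ac 1; apply: h; exists x. Qed.

Lemma differential_chart c J x (v : tangent x) : smooth_function J -> atlas c ->
  chart_dom c x ->
  differential J v = 'd (J \o chart_inv c) (chart_map c x) (coords c v).
Proof.
move=> sJ ac cx; set c0 := chart_at x.
have ac0 : atlas c0 := atlas_chart_at x.
have c0x : chart_dom c0 x := chart_dom_chart_at x.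
have d1 := transition_differentiable ac0 ac c0x cx.
have E : (chart_map c \o chart_inv c0) (chart_map c0 x) = chart_map c x.
  by rewrite /= chart_mapK ?inE.
have d2 : differentiable (J \o chart_inv c) ((chart_map c \o chart_inv c0) (chart_map c0 x)).
  by rewrite E; exact: smooth_function_diff.
rewrite /coords -/c0 -E.
have := diff_comp d1 d2 => /(congr1 (fun f => f v)) /= <-.
rewrite /differential -/c0.
have JE : \forall y \near chart_map c0 x,
    ((J \o chart_inv c) \o (chart_map c \o chart_inv c0)) y = (J \o chart_inv c0) y.
  have := near_chart_image c0x (chart_dom_open c) cx.
  by apply: filterS => y [c0y cy]; rewrite /= chart_mapK ?inE.
by have [_ ->] := near_eq_diff JE (differentiable_comp d1 d2).
Qed.

Lemma smooth_lie_derivative c (f : vector_field M) J : atlas c ->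
  smooth_vector_field_on setT f -> smooth_function J ->
  smooth_on (chart_map c @` chart_dom c)
    (fun y => lie_derivative f J (chart_inv c y)).
Proof.
move=> ac sf sJ k; have oc := @chart_img_open _ _ _ c.
have := sf c ac k; rewrite setIT => sfc.
apply: (@Ck_ext _ _ _ _ _ (fun y => \sum_(i < n) coords c (f (chart_inv c y)) 0 i *
    'D_(delta_mx 0 i) (J \o chart_inv c) y)) => //.
  move=> y cy; have [h1 h2] := chart_invP cy.
  have dJ := smooth_function_diff sJ ac h1; rewrite h2 in dJ.
  rewrite /lie_derivative (differential_chart _ sJ ac h1) h2.
  rewrite [in RHS](row_sum_delta (coords c (f (chart_inv c y)))) linear_sum.
  by apply: eq_bigr => i _; rewrite linearZ deriveE.
apply: Ck_sum => // i _; apply: CkM => //; first exact: ((Ck_mxP _ _ oc).1 sfc 0 i).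
by have [_] := sJ c ac k.+1; exact.
Qed.

(** The derivative of a solution is prescribed in the preferred chart of the
    current point, which varies along the curve; the chain rule moves it to a
    fixed chart. *)
Lemma chart_curve c (x : R -> M) (F : vector_field M) (t : R) : atlas c ->
  {for t, continuous x} -> chart_dom c (x t) ->
  is_derive t (1 : R) (chart_map (chart_at (x t)) \o x) (F (x t)) ->
  is_derive t (1 : R) (chart_map c \o x) (coords c (F (x t))).
Proof.
move=> ac xt cx D; set c0 := chart_at (x t) in D *.
have ac0 : atlas c0 := atlas_chart_at _.
have c0x : chart_dom c0 (x t) := chart_dom_chart_at _.
have d1 := transition_differentiable ac0 ac c0x cx.
have := is_derive_comp_diff D (differentiableP d1).
apply: near_eq_is_derive.
have : \forall s \near t, chart_dom c0 (x s).
  by apply: xt; apply: open_nbhs_nbhs; split=> //; exact: chart_dom_open.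
by apply: filterS => s cs; rewrite /= chart_mapK ?inE.
Qed.

(** The converse of [chart_curve], for a curve given in a fixed chart. *)
Lemma curve_chart c (y : R -> 'rV[R]_n) (F : vector_field M) (t : R) : atlas c ->
  (chart_map c @` chart_dom c) (y t) ->
  is_derive t (1 : R) y (coords c (F (chart_inv c (y t)))) ->
  is_derive t (1 : R) (chart_map (chart_at (chart_inv c (y t))) \o (chart_inv c \o y))
    (F (chart_inv c (y t))).
Proof.
move=> ac cy D; have [h1 h2] := chart_invP cy.
set x := chart_inv c (y t) in D h1 h2 *.
have d := transition_differentiable ac (atlas_chart_at x) h1 (chart_dom_chart_at x).
have E := coordsK (F x) ac h1.
rewrite h2 in d E; rewrite -[X in is_derive _ _ _ X]E.
exact: is_derive_comp_diff D (differentiableP d).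
Qed.

Lemma forward_solution_continuous (F : vector_field M) (x : R -> M) (t : R) :
  forward_solution F x -> 0 < t -> {for t, continuous x}.
Proof.
move=> [/subspace_continuousP xc _] t0.
have h := xc t (ltW t0).
move=> P /h nP; have tpos : \forall s \near t, 0 <= s.
  by near=> s; apply: ltW; near: s; exact: lt_nbhsr.
have : \forall s \near t, 0 <= s -> P (x s) by exact: nP.
by move: tpos; apply: filterS2 => s s0; apply.
Unshelve. all: by end_near. Qed.

(** Along solutions [W] decays at rate [mu]; being comparable with the squared
    norm, it makes the norm decay at rate [mu / 2]. The sublevel sets of [W] are
    compact, hence closed in the manifold, as trapping requires. *)
Lemma dissipative_exponentially_stable c (F : vector_field M) (p e : 'rV[R]_n) m (Q : 'M[R]_(n, m))
    (r K mu rho : R) (G := fun y => coords c (F (chart_inv c y)))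
    (W := fun v : 'rV[R]_n => dotp (v *m Q) (v *m Q)) :
  atlas c -> row_free Q -> 0 < r -> 0 < K -> 0 < mu -> 0 < rho ->
  (forall y, `|y - p| <= r -> (chart_map c @` chart_dom c) y) ->
  (forall x y : 'rV[R]_n, `|x - p| <= r -> `|y - p| <= r -> `|G x - G y| <= K * `|x - y|) ->
  (forall y, `|y - p| <= r -> dotp (G y *m Q) ((y - e) *m Q) <= - (mu / 2) * W (y - e)) ->
  (forall y, W (y - e) <= rho -> `|y - p| <= r) ->
  G e = 0 -> locally_exponentially_stable F (chart_inv c e).
Proof.
move=> ac Qf r0 K0 mu0 rho0 box GL Gdec Wr Ge.
have er : `|e - p| <= r by apply: Wr; rewrite subrr /W mul0mx dotp0l ltW.
have [ce ee] := chart_invP (box _ er).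
have [a [b [a0 b0 abP]]] := dotp_norm_equiv Qf.
split; first exact: coords_eq0 ac ce Ge.
exists c => //; rewrite ee.
(* The radius [Num.sqrt (rho / b)] keeps the initial value of [W] below [rho]. *)
exists (Num.sqrt (b / a)), (mu / 2), (Num.sqrt (rho / b)).
split; rewrite ?sqrtr_gt0 ?divr_gt0// => q cq qd.
have Wq : W (chart_map c q - e) < rho.
  have /andP[_ h] := abP (chart_map c q - e); apply: le_lt_trans h _.
  rewrite mulrC -ltr_pdivlMr// -[ltRHS]sqr_sqrtr ?divr_ge0 ?ltW//.
  by rewrite ltr_pXn2r ?nnegrE ?sqrtr_ge0.
have wc := @quad_continuous R n m Q e.
split.
  have [y [y0 yc yW yd]] := box_solution r0 K0 (ltW mu0) GL Gdec Wr Wq.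
  have yimg (t : R) : 0 <= t -> (chart_map c @` chart_dom c) (y t).
    by move=> t0; apply/box/Wr/yW.
  exists (chart_inv c \o y); last by rewrite /= y0 chart_mapK ?inE.
  split; last by move=> t t0; apply: curve_chart (yd t t0) => //; exact/yimg/ltW.
  apply: continuous_in_subspaceT => t /set_mem t0.
  by apply: continuous_comp; [exact: yc|exact/chart_inv_at/yimg].
move=> x Fx x0 t t0.
pose w z := W (chart_map c z - e).
have wz z : chart_dom c z -> {for z, continuous w}.
  move=> cz; apply: (@continuous_comp _ _ _ (chart_map c) (fun y => W (y - e))).
    exact: chart_map_at.
  exact: wc.
have cK : closed (chart_dom c `&` [set z | w z <= rho]).
  have -> : chart_dom c `&` [set z | w z <= rho] =
      chart_inv c @` [set y | W (y - e) <= rho].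
    apply/seteqP; split=> [z [cz wzr]|z [y yr <-]].
      by exists (chart_map c z) => //; rewrite chart_mapK ?inE.
    have [h1 h2] := chart_invP (box _ (Wr _ yr)).
    by split=> //; rewrite /w /= h2.
  apply: compact_closed; first exact: manifold_hausdorff.
  apply: continuous_compact.
    by apply: continuous_in_subspaceT => y /set_mem yr; exact/chart_inv_at/box/Wr.
  apply: bounded_closed_compact.
    exists (`|p| + r); split; first exact: num_real.
    move=> B hB y Sy; apply: le_trans (ltW hB).
    rewrite -[y](subrK p) addrC; apply: le_trans (ler_normD _ _) _.
    by rewrite lerD2l Wr.
  have -> : [set y | W (y - e) <= rho] = (fun y => W (y - e)) @^-1` [set z | z <= rho] by [].
  by apply: preimage_closed; [move=> y _; exact: wc|exact: closed_le].
have [|||cxt wt] := @sublevel_trapping R _ x (chart_dom c) w rho mu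
   (chart_dom_open c) wz cK (ltW mu0)
   (fun z _ => dotp_ge0 _) Fx.1 _ _ _ t t0.
- by rewrite x0.
- by rewrite x0.
- move=> s s0 cs ws.
  have D := chart_curve ac (forward_solution_continuous Fx s0) cs (Fx.2 s s0).
  exists (2 * dotp (coords c (F (x s)) *m Q) ((chart_map c (x s) - e) *m Q)).
    exact: (is_derive_dotp Q e D).
  have := Gdec _ (Wr _ ws); rewrite /G chart_mapK ?inE// => h.
  rewrite -(@ler_pM2l _ 2)// in h; apply: le_trans h _.
  by rewrite mulrA mulrN mulrCA divff// mulr1.
split=> //; rewrite x0 in wt.
set z := chart_map c (x t) - e; set z0 := chart_map c q - e.
have /andP[h1 _] := abP z; have /andP[_ h2] := abP z0.
rewrite -(@ler_pXn2r _ 2)// ?nnegrE ?mulr_ge0 ?sqrtr_ge0 ?expR_ge0//.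
rewrite !exprMn sqr_sqrtr ?divr_ge0 ?(ltW a0) ?(ltW b0)//.
have -> : expR (- (mu / 2 * t)) ^+ 2 = expR (- (mu * t)).
  by rewrite -expRM_natl; congr expR; field.
rewrite -(ler_pM2l a0); apply: le_trans h1 _; apply: le_trans wt _.
have -> : a * (b / a * expR (- (mu * t)) * `|z0| ^+ 2) = expR (- (mu * t)) * (b * `|z0| ^+ 2).
  by field; rewrite gt_eqF.
by rewrite ler_wpM2l ?expR_ge0.
Qed.

End Charts.

(** * The deceptive dynamics *)

Section DeceptiveDynamics.
Context {R : realType} {n : nat} (M : smoothManifold R n).
Variables (d1 d2 : nat) (f1 : 'I_d1 -> vector_field M) (f2 : 'I_d2 -> vector_field M).
Variables (J1 J2 : M -> R) (kappa1 kappa2 : R).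
Hypotheses (smooth_f1 : forall j, smooth_vector_field_on setT (f1 j))
  (smooth_f2 : forall j, smooth_vector_field_on setT (f2 j))
  (smooth_J1 : smooth_function J1) (smooth_J2 : smooth_function J2).

Definition deceptive (g : 'M[R]_(d1, d2)) : vector_field M :=
  dynamics kappa1 kappa2 f1 (tilted_field g f1 f2) J1 J2.

Definition chart_deceptive (c : chart R n M) (z : 'M[R]_(d1, d2) * 'rV[R]_n) : 'rV[R]_n :=
  coords c (deceptive z.1 (chart_inv c z.2)).

Lemma deceptive0 : deceptive 0 = dynamics kappa1 kappa2 f1 f2 J1 J2.
Proof.
rewrite /deceptive; congr dynamics; apply/funext => j; apply/functional_extensionality_dep => x.
by rewrite /tilted_field big1 ?addr0// => k _; rewrite mxE scale0r.
Qed.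

Lemma coords_sum c (x : M) (I : Type) (r : seq I) (v : I -> tangent x) :
  coords c (\sum_(i <- r) v i : tangent x) = \sum_(i <- r) coords c (v i).
Proof. exact: linear_sum. Qed.

Lemma coordsD c (x : M) (u v : tangent x) : coords c (u + v : tangent x) = coords c u + coords c v.
Proof. exact: linearD. Qed.

Lemma coordsZ c (x : M) a (v : tangent x) : coords c (a *: v : tangent x) = a *: coords c v.
Proof. exact: linearZ. Qed.

Lemma coords_tilted c g j (x : M) : coords c (tilted_field g f1 f2 j x) =
  coords c (f2 j x) + \sum_(k < d1) g k j *: coords c (f1 k x).
Proof.
rewrite /tilted_field coordsD coords_sum; congr (_ + _).
by apply: eq_bigr => k _; rewrite coordsZ.
Qed.

Lemma lie_derivative_tilted g j J (x : M) : lie_derivative (tilted_field g f1 f2 j) J x =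
  lie_derivative (f2 j) J x + \sum_(k < d1) g k j * lie_derivative (f1 k) J x.
Proof.
rewrite /lie_derivative /differential /tilted_field linearD linear_sum; congr (_ + _).
by apply: eq_bigr => k _; rewrite linearZ.
Qed.

(** In the coordinates of a chart the deceptive dynamics are built by sums and
    products from the entries of the parameter matrix, the components of the
    fields and their Lie derivatives. *)
Lemma smooth_chart_deceptive c : atlas c ->
  smooth_on [set z | (chart_map c @` chart_dom c) z.2] (chart_deceptive c).
Proof.
move=> ac k; set B := [set z | _].
have oc := @chart_img_open _ _ _ c.
have oB : open B.
  have -> : B = snd @^-1` (chart_map c @` chart_dom c) by [].
  by apply: open_comp => // z _; exact: cvg_snd.
have sndc : continuous (snd : 'M[R]_(d1, d2) * 'rV[R]_n -> 'rV[R]_n).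
  by move=> z; exact: cvg_snd.
have fstc : continuous (fst : 'M[R]_(d1, d2) * 'rV[R]_n -> 'M[R]_(d1, d2)).
  by move=> z; exact: cvg_fst.
have onsnd (W : normedModType R) (h : 'rV[R]_n -> W) :
    smooth_on (chart_map c @` chart_dom c) h -> Ck_on k B (fun z => h z.2).
  move=> sh; pose L : {linear ('M[R]_(d1, d2) * 'rV[R]_n)%type -> 'rV[R]_n} := snd.
  exact: (@Ck_comp_linear R _ _ _ k (chart_map c @` chart_dom c) B h L oB sndc
    (fun z Bz => Bz) (sh k)).
have gkj i j : Ck_on k B (fun z : 'M[R]_(d1, d2) * 'rV[R]_n => z.1 i j).
  pose L : {linear ('M[R]_(d1, d2) * 'rV[R]_n)%type -> 'M[R]_(d1, d2)} := fst.
  exact: ((Ck_mxP k (L : _ -> _) oB).1 (@Ck_linear _ _ _ k B L fstc) i j).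
have sf f : smooth_vector_field_on setT f ->
    smooth_on (chart_map c @` chart_dom c) (fun y => coords c (f (chart_inv c y))).
  by move=> /(_ c ac); rewrite setIT.
have sl f J : smooth_vector_field_on setT f -> smooth_function J ->
    Ck_on k B (fun z => lie_derivative f J (chart_inv c z.2)).
  by move=> ff JJ; exact: (onsnd _ _ (smooth_lie_derivative ac ff JJ)).
pose H (z : 'M[R]_(d1, d2) * 'rV[R]_n) : 'rV[R]_n :=
  kappa1 *: (\sum_(j < d1) lie_derivative (f1 j) J1 (chart_inv c z.2) *:
               coords c (f1 j (chart_inv c z.2))) +
  kappa2 *: (\sum_(j < d2)
     (lie_derivative (f2 j) J2 (chart_inv c z.2) +
      \sum_(k < d1) z.1 k j * lie_derivative (f1 k) J2 (chart_inv c z.2)) *: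
     (coords c (f2 j (chart_inv c z.2)) +
      \sum_(k < d1) z.1 k j *: coords c (f1 k (chart_inv c z.2)))).
apply: (@Ck_ext _ _ _ _ _ H) => //.
  move=> z _; rewrite /chart_deceptive /deceptive /dynamics coordsD !coordsZ !coords_sum.
  congr (_ *: _ + _ *: _); apply: eq_bigr => j _; rewrite coordsZ//.
  by rewrite coords_tilted lie_derivative_tilted.
apply: CkD => //; apply: CkZ => //; [exact: Ck_cst| |exact: Ck_cst|];
  apply: Ck_sum => // j _; apply: CkZ => //.
- exact: sl.
- exact: (onsnd _ _ (sf _ (smooth_f1 j))).
- apply: CkD => //; first exact: sl.
  by apply: Ck_sum => // i _; apply: CkM => //; exact: sl.
- apply: CkD => //; first exact: (onsnd _ _ (sf _ (smooth_f2 j))).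
  by apply: Ck_sum => // i _; apply: CkZ => //; exact: (onsnd _ _ (sf _ (smooth_f1 i))).
Qed.

Lemma chart_inv_smooth_map (V : normedModType R) c (A : set V) (xi : V -> 'rV[R]_n) :
  atlas c -> open A -> (forall g, A g -> (chart_map c @` chart_dom c) (xi g)) ->
  smooth_on A xi -> smooth_map_on A (chart_inv c \o xi : V -> M).
Proof.
move=> ac oA Axi sxi.
have Xc g : A g -> {for g, continuous (chart_inv c \o xi)}.
  move=> Ag; apply: continuous_comp; last exact/chart_inv_at/Axi.
  exact: Ck_continuous (sxi 0) Ag.
split=> [g /set_mem /Xc//|c' ac' k].
set A' := A `&` _.
have oA' : open A'.
  rewrite openE => g [Ag c'g].
  have h1 : \forall h \near g, A h by exact: open_nbhs_nbhs.
  have h2 : \forall h \near g, chart_dom c' (chart_inv c (xi h)).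
    by apply: (Xc _ Ag); apply: open_nbhs_nbhs; split=> //; exact: chart_dom_open.
  by near=> h; split; near: h.
pose B := [set z : V * 'rV[R]_n | (chart_map c @` (chart_dom c `&` chart_dom c')) z.2].
have oI : open (chart_map c @` (chart_dom c `&` chart_dom c')).
  by apply: open_chart_image; exact: chart_dom_open.
have sndc : continuous (snd : V * 'rV[R]_n -> 'rV[R]_n) by move=> z; exact: cvg_snd.
have oB : open B.
  have -> : B = snd @^-1` (chart_map c @` (chart_dom c `&` chart_dom c')) by [].
  by apply: open_comp => // z _; exact: cvg_snd.
apply/(Ck_mxP _ _ oA') => i j.
have tau := (Ck_mxP _ _ oI).1 (atlas_smooth ac ac' k) i j.
have tauB : Ck_on k B ((fun y => (chart_map c' (chart_inv c y)) i j) \o snd).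
  pose L : {linear (V * 'rV[R]_n)%type -> 'rV[R]_n} := snd.
  exact: (@Ck_comp_linear R _ _ _ k _ B _ L oB sndc (fun z Bz => Bz) tau).
apply: (Ck_comp_pair oA' _ tauB) => //.
  by move=> g [Ag c'g]; apply/chart_imageP; split=> //; exact: Axi.
by apply: Ck_subset (sxi k) => g [].
Unshelve. all: by end_near. Qed.

End DeceptiveDynamics.

Theorem theorem3 (R : realType) (n : nat) (M : smoothManifold R n)
  (d1 d2 : nat)
  (f1 : 'I_d1 -> vector_field M) (f2 : 'I_d2 -> vector_field M)
  (J1 J2 : M -> R) (kappa1 kappa2 : R) (U : set M) (xstar : M)
  (smooth_f1 : forall j, smooth_vector_field_on setT (f1 j))
  (smooth_f2 : forall j, smooth_vector_field_on setT (f2 j))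
  (smooth_J1 : smooth_function J1) (smooth_J2 : smooth_function J2)
  (kappa1_gt0 : 0 < kappa1) (kappa2_gt0 : 0 < kappa2)
  (open_U : open U)
  (regular_E1 : regular_distribution_on U (span_fields f1))
  (regular_E2 : regular_distribution_on U (span_fields f2))
  (tangent_sum : forall x, U x ->
     (span_fields f1 x + span_fields f2 x)%VS = fullv /\
     directv (span_fields f1 x + span_fields f2 x))
  (free_f1 : forall x, U x -> linearly_independent_at f1 x)
  (free_f2 : forall x, U x -> linearly_independent_at f2 x)
  (U_xstar : U xstar)
  (stable_xstar :
     locally_exponentially_stable (dynamics kappa1 kappa2 f1 f2 J1 J2) xstar) :
  exists (Omega : set 'M[R]_(d1, d2)) (X : 'M[R]_(d1, d2) -> M),
    [/\ open Omega /\ Omega 0,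
        (forall gamma, Omega gamma -> U (X gamma)) /\ smooth_map_on Omega X,
        X 0 = xstar &
        forall gamma, Omega gamma ->
          locally_exponentially_stable
            (dynamics kappa1 kappa2 f1 (tilted_field gamma f1 f2) J1 J2)
            (X gamma)].
Proof.
have [Fx0 [c [ac cx] [C [lam [delta [C0 lam0 delta0 stab]]]]]] := stable_xstar.
pose G := chart_deceptive f1 f2 J1 J2 kappa1 kappa2 c.
pose p := chart_map c xstar.
(* Restricting the positions to the image of [U] keeps the equilibria in [U]. *)
pose B := [set z : 'M[R]_(d1, d2) * 'rV[R]_n |
  (chart_map c @` (chart_dom c `&` U)) z.2].
have oI : open (chart_map c @` (chart_dom c `&` U)) by exact: open_chart_image.
have oB : open B.
  have -> : B = snd @^-1` (chart_map c @` (chart_dom c `&` U)) by [].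
  by apply: open_comp => // z _; exact: cvg_snd.
have smG : smooth_on B G.
  move=> k; apply: Ck_subset (smooth_chart_deceptive _ _
    smooth_f1 smooth_f2 smooth_J1 smooth_J2 ac k).
  by move=> z /chart_imageP[].
have invp : chart_inv c p = xstar by rewrite chart_mapK ?inE.
have Bp : B (0, p) by exists xstar.
have Gp : G (0, p) = 0.
  by rewrite /G /chart_deceptive /= invp deceptive0 Fx0; exact: linear0.
pose A := jac2 G (0, p).
have G0diff : is_diff p (fun y => G (0, y)) (mulmx^~ A).
  have dGp := smooth_differentiable smG Bp.
  have h : is_diff p (fun y : 'rV[R]_n => (0 : 'M[R]_(d1, d2), y)) (fun y => (0, y)).
    by apply: (is_diff_pair (df := 0)); exact: is_diff_cst || exact: is_diff_id.
  have := is_diff_comp h (differentiableP dGp).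
  by congr (is_diff _ _ _); apply/funext => v /=; rewrite (diff_jac2 smG).
have [s /= s0 sP] : exists2 s : R, 0 < s &
    forall y, `|y - p| < s -> (chart_map c @` chart_dom c) y.
  have : (chart_map c @` chart_dom c) p by exists xstar.
  move=> /(conj (@chart_img_open _ _ _ c)) /open_nbhs_nbhs /nbhs_ballP[s /= s0 sP].
  by exists s => // y ys; apply: sP; rewrite -ball_normE /= distrC.
have sol q : `|q - p| < Num.min delta s -> exists y : R -> 'rV[R]_n,
     [/\ y 0 = q, {within [set t : R | 0 <= t], continuous y},
        forall t : R, 0 < t -> is_derive t 1 y (G (0, y t)) &
        forall t : R, 0 <= t ->
          `|y t - p| <= C * expR (- (lam * t)) * `|q - p|].
  rewrite lt_min => /andP[qd qs].
  have [cq qE] := chart_invP (sP _ qs).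
  have := stab (chart_inv c q) cq; rewrite qE => /(_ qd) [[x Fx x0] xall].
  have xb := xall x Fx x0.
  exists (chart_map c \o x); split.
  - by rewrite /= x0.
  - apply/subspace_continuousP => t t0.
    apply: cvg_comp ((subspace_continuousP _ _).1 Fx.1 t t0) _.
    exact: chart_map_at (xb t t0).1.
  - move=> t t0; have [ct _] := xb t (ltW t0).
    have := chart_curve ac (forward_solution_continuous Fx t0) ct (Fx.2 t t0).
    by rewrite /G /chart_deceptive /= chart_mapK ?inE// deceptive0.
  - by move=> t t0; exact: (xb t t0).2.
have ds0 : 0 < Num.min delta s by rewrite lt_min delta0.
have nomode := stable_no_unstable_mode (G := fun y => G (0, y)) Gp G0diff C0 lam0 ds0 sol.
have [m [Q [mu [Qf mu0 lyap]]]] := hurwitz_lyapunov nomode.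
have [r [K [r0 K0 nbhdP]]] := uniform_nbhd oB smG Bp Qf mu0 lyap.
have [r1 r10 zex] := zero_exists smG Bp Gp Qf mu0 r0 nbhdP.
have xi_ex g : {y : 'rV[R]_n | `|g| < r1 -> [/\ `|g| < r, `|y - p| <= r / 2 & G (g, y) = 0]}.
  apply: cid; have [gr|gr] := pselect (`|g| < r1); last by exists 0.
  by have [? [y ? ?]] := zex g gr; exists y.
pose xi g := projT1 (xi_ex g).
have xiP g : `|g| < r1 -> [/\ `|g| < r, `|xi g - p| <= r / 2 & G (g, xi g) = 0] := projT2 (xi_ex g).
have r2r : r / 2 <= r by rewrite ler_pdivrMr// ler_peMr ?ler1n// ltW.
have xiP' g : `|g| < r1 -> [/\ `|g| < r, `|xi g - p| <= r & G (g, xi g) = 0].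
  by move=> /xiP[h1 h2 h3]; split=> //; exact: le_trans r2r.
have sxi := zero_smooth oB smG Qf mu0 nbhdP xiP'.
pose Omega := [set g : 'M[R]_(d1, d2) | `|g| < r1].
have oOmega : open Omega.
  have -> : Omega = ball (0 : 'M[R]_(d1, d2)) r1.
    by apply/seteqP; split => g; rewrite -ball_normE /Omega /= sub0r normrN.
  exact: ball_open.
have xiB g : Omega g -> (chart_map c @` (chart_dom c `&` U)) (xi g).
  by move=> /xiP'[gr yr _]; have [] := nbhdP _ _ gr yr.
have O0 : Omega 0 by rewrite /Omega /= normr0.
exists Omega, (chart_inv c \o xi); split=> //.
- split; first by move=> g /xiB/chart_imageP[].
  by apply: chart_inv_smooth_map => // g /xiB/chart_imageP[].
- rewrite /= (_ : xi 0 = p)//.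
  have [h1 h2 h3] := xiP' 0 O0.
  apply: (zero_unique smG Qf mu0 nbhdP h1 h2 _ h3 Gp).
  by rewrite subrr normr0 ltW.
move=> g Og; have [gr yr2 Gy] := xiP g Og; have [_ yr _] := xiP' g Og.
have [a [b [a0 b0 abP]]] := dotp_norm_equiv Qf.
apply: (@dissipative_exponentially_stable _ _ _ c _ p (xi g) m Q r K mu (a * (r / 2) ^+ 2)) => //.
- by rewrite mulr_gt0// exprn_gt0// divr_gt0.
- by move=> y yr'; have [/chart_imageP[]] := nbhdP g y gr yr'.
- by move=> x y xr yr'; exact: (family_lipschitz smG K0 nbhdP gr xr yr').
- move=> y yr'; have := strongly_monotone smG nbhdP gr yr' yr.
  by rewrite Gy subr0.
- move=> y Wy; have /andP[h _] := abP (y - xi g).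
  have := le_trans h Wy; rewrite ler_pM2l// ler_pXn2r ?nnegrE ?divr_ge0 ?(ltW r0)// => h2.
  rewrite -(subrK (xi g) y) -addrA; apply: le_trans (ler_normD _ _) _.
  by rewrite [leRHS]splitr lerD.
Qed.
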